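(* Let $U$ be a universal prefix-free machine and let $X\subseteq 2^{<\omega}$ be a nonempty $\Pi^0_1$ set. Then the number $\Omega_U(X)=\sum_{U(\sigma)\downarrow\in X}2^{-|\sigma|}$ is a Martin-Löf random left-c.e. real.
   Context: A prefix-free machine is a partial computable function $M:2^{<\omega}\to 2^{<\omega}$ whose domain is prefix-free. Fix an effective list $(M_e)$ of all prefix-free machines. A prefix-free machine $U$ is universal if there is a computable function $e\mapsto\sigma_e$ such that for all $e$ and all $\tau\in 2^{<\omega}$, $U(\sigma_e\tau)\simeq M_e(\tau)$ (both sides undefined, or both defined and equal). For a set $X$ of strings, $\Omega_U(X)=\sum_{\sigma:\,U(\sigma)\downarrow\in X}2^{-|\sigma|}$ is the probability that $U$ halts with output in $X$. A $\Pi^0_1$ set is one whose complement is computably enumerable. A real is left-c.e. if it is the limit of a computable increasing sequence of rationals. A real is Martin-Löf random if (the binary expansion of its fractional part) is Martin-Löf random. *)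

(* Defs.v *)
From HB Require Import structures.
From mathcomp Require Import all_boot all_order all_algebra.
From mathcomp Require Import boolp classical_sets reals topology normedtype sequences.
Set Implicit Arguments. Unset Strict Implicit. Unset Printing Implicit Defensive.
Import Order.TTheory GRing.Theory Num.Theory.
Import numFieldNormedType.Exports.

Inductive code : Type :=
| CZero : code
| CSucc : code
| CProj : nat -> code
| CComp : code -> seq code -> code
| CPrec : code -> code -> code
| CMu   : code -> code.

Inductive eval : code -> seq nat -> nat -> Prop :=
| ev_zero v : eval CZero v 0
| ev_succ v : eval CSucc v (head 0 v).+1
| ev_proj i v : eval (CProj i) v (nth 0 v i)
| ev_comp f gs v ws y : evals gs v ws -> eval f ws y -> eval (CComp f gs) v y
| ev_prec0 f g w y : eval f w y -> eval (CPrec f g) (0 :: w) y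
| ev_precS f g n w z y :
    eval (CPrec f g) (n :: w) z -> eval g (n :: z :: w) y ->
    eval (CPrec f g) (n.+1 :: w) y
| ev_mu f v n :
    eval f (n :: v) 0 -> (forall m, m < n -> exists k, eval f (m :: v) k.+1) ->
    eval (CMu f) v n
with evals : seq code -> seq nat -> seq nat -> Prop :=
| evs_nil v : evals [::] v [::]
| evs_cons g gs v y ys : eval g v y -> evals gs v ys -> evals (g :: gs) v (y :: ys).

(* Binary strings 2^{<omega} are [seq bool]; the standard bijection with nat:
   s |-> (the number with binary expansion 1s) - 1. *)
Definition enc (s : seq bool) : nat := (foldl (fun acc (b : bool) => acc.*2 + b) 1 s).-1.

Definition total_computable (f : nat -> nat) : Prop :=
  exists c, forall n, eval c [:: n] (f n).
Definition total_computable_str (f : nat -> seq bool) : Prop :=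
  exists c, forall n, eval c [:: n] (enc (f n)).

Definition pfun := seq bool -> option (seq bool).

Definition partial_computable (M : pfun) : Prop :=
  exists c, forall s t, M s = Some t <-> eval c [:: enc s] (enc t).

Definition prefix_free_dom (M : pfun) : Prop :=
  forall s t, M s <> None -> M t <> None -> prefix s t -> s = t.

Definition prefix_free_machine (M : pfun) : Prop :=
  partial_computable M /\ prefix_free_dom M.

Definition effective_list_pfm (L : nat -> pfun) : Prop :=
  [/\ (exists c, forall e s t, L e s = Some t <-> eval c [:: e; enc s] (enc t)),
      (forall e, prefix_free_dom (L e)) &
      (forall M, prefix_free_machine M -> exists e, forall s, L e s = M s)].

Definition universal_pfm (L : nat -> pfun) (U : pfun) : Prop :=
  prefix_free_machine U /\
  exists sig : nat -> seq bool, total_computable_str sig /\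
    forall e t, U (sig e ++ t) = L e t.

Definition ce_set (A : seq bool -> Prop) : Prop :=
  exists c, forall s, A s <-> exists y, eval c [:: enc s] y.
Definition Pi01_set (X : seq bool -> Prop) : Prop := ce_set (fun s => ~ X s).

Local Open Scope ring_scope.

Definition halting_prob (R : realType) (U : pfun) (X : seq bool -> Prop) : R :=
  limn (series (fun k : nat =>
     \sum_(s : k.-tuple bool | `[< exists t, U (tval s) = Some t /\ X t >])
         (2%:R ^- k : R))).

Definition left_ce (R : realType) (x : R) : Prop :=
  exists a b d : nat -> nat,
    [/\ total_computable a, total_computable b, total_computable d &
      let q := fun n => ((a n)%:R - (b n)%:R) / (d n).+1%:R : R in
      (forall n, q n <= q n.+1) /\ (q n @[n --> \oo] --> x)%classic]%type.

(* Lebesgue measure of the open subset of Cantor space generated by W: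
   the supremum over k of the proportion of length-k strings extending
   an element of W. *)
Definition cyl_count (W : seq bool -> Prop) (k : nat) : nat :=
  #|[set s : k.-tuple bool | `[< exists w, W w /\ prefix w (tval s) >]]|.
Definition lambda_open (R : realType) (W : seq bool -> Prop) : R :=
  sup [set ((cyl_count W k)%:R / (2%:R ^+ k) : R) | k in [set: nat]].

Definition ML_test (R : realType) (W : nat -> seq bool -> Prop) : Prop :=
  (exists c, forall n s, W n s <-> exists y, eval c [:: n; enc s] y) /\
  (forall n, lambda_open R (W n) <= 2%:R ^- n).

Definition ML_random (R : realType) (Z : nat -> bool) : Prop :=
  forall W, ML_test R W -> exists n, ~ (exists w, W n w /\ w = mkseq Z (size w)).

(* Binary expansion of the fractional part of x: bit n is the coefficient
   of 2^{-(n+1)} (the expansion not ending in all 1s). *)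
Definition frac_bits (R : realType) (x : R) : nat -> bool :=
  let f := x - (Num.floor x)%:~R in
  fun n => odd (Num.truncn (2%:R ^+ n.+1 * f)).

Definition ML_random_real (R : realType) (x : R) : Prop :=
  ML_random R (frac_bits x).

(* Main.v *)
(** Fix [x] in [X] and an index of the machine sending all of dom [U] to [x]; it gives a
string [rho] of length [r] such that [U(rho s)] outputs [x] exactly when [U(s)] halts.
Let [A] be the weight of the strings in dom [U] that do not extend [rho], and [B] the
weight of the strings in dom [U] with output outside [X]. Both are left-c.e., with
approximations [A_s] and [B_s], and Omega_U(X) = (1 + d) A - B with d = 1 / (2^r - 1).

A request machine, whose strings are all counted in [A], can force [A] to grow by any
prescribed computable sequence of amounts, up to a constant factor. This is used twice.

First, (1 + d/2) (A - A_s) >= B - B_s for all large [s]. If not, [A] lies in nested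
intervals [A_s, A_s + l] with l <= B_t - B_s and (1 + d/2) (A_t - A_s) <= l, opened
whenever [B] grows relatively fast. Inside an interval opened at stage [tau], the
increase of [B] used by the subintervals comes either from one of the finitely many
strings of length at most [tau], each of which costs at most a prescribed tiny amount,
or from longer strings, whose weight is bounded by the growth of [A]. Hence each level
has total length at most a fixed fraction of the previous one, and requesting the
lengths of a deep enough level pushes [A] out of its interval. Consequently
(1 + d) A_s - B_s is eventually below its limit, by a margin of (d/2) (A - A_s).

Second, by this margin Omega_U(X) itself can be forced to grow, and so to leave the
cylinders of a given Martin-Loef test. *)

From mathcomp Require Import all_boot all_order all_algebra.
From mathcomp Require Import zify ring lra.
From mathcomp Require Import boolp classical_sets reals topology normedtype sequences.
Require Import Defs.
Set Implicit Arguments. Unset Strict Implicit. Unset Printing Implicit Defensive.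
Import Order.TTheory GRing.Theory Num.Theory.
Import numFieldNormedType.Exports.

(** * Codes *)

(** The obstacle is that X is only co-enumerable: weight already counted is lost when an output is
    enumerated out of X, so a priori Omega_U(X) is a mere difference of left-c.e. reals. Strings
    extending [rho] never lose weight, because their output x stays in X. They form a copy of dom U
    scaled by 2^-r, so dom U weighs (1 + d) A, and d is the surplus that pays for B: half of it
    makes the growth of A dominate the growth of B, the other half is the margin left over. Strings
    counted in B never extend [rho], so they are also counted in A; this is why the late long
    strings of B are bounded by the growth of A.

    A machine serves its requests only up to the factor 2^-k, where k is a length that depends on
    its index. Requests are therefore functions of a candidate index e as well, and the strategy for
    e (depth of the frames, level of the test) is chosen from the constant [K e]. To keep every test
    decidable, stage values are compared as integers in a common dyadic unit. *)

Fixpoint code_nested_ind (P : code -> Prop) (H0 : P CZero) (HS : P CSucc)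
    (Hp : forall i, P (CProj i))
    (Hc : forall f gs, P f -> foldr (fun g Q => P g /\ Q) True gs -> P (CComp f gs))
    (Hr : forall f g, P f -> P g -> P (CPrec f g))
    (Hm : forall f, P f -> P (CMu f)) (c : code) : P c :=
  let rec := code_nested_ind H0 HS Hp Hc Hr Hm in
  match c with
  | CZero => H0 | CSucc => HS | CProj i => Hp i
  | CComp f gs => Hc f gs (rec f)
      ((fix go (l : seq code) : foldr (fun g Q => P g /\ Q) True l :=
          match l with [::] => I | g :: l' => conj (rec g) (go l') end) gs)
  | CPrec f g => Hr f g (rec f) (rec g)
  | CMu f => Hm f (rec f)
  end.

(** State of a search: 0 while all values so far are positive, 1 once an undefined value has blocked
    it, [n.+2] once the zero [n] is found. Values are coded as in [run], so [h m == 1] means output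
    0. *)
Definition mu_step (h : nat -> nat) (m acc : nat) : nat :=
  if acc == 0 then (if h m == 0 then 1 else if h m == 1 then m.+2 else 0) else acc.

(* [run c s v] is [y.+1] if [c] outputs [y] on [v] with all unbounded searches
   cut off at [s], and [0] if no output is found. *)
Fixpoint run (c : code) (s : nat) (v : seq nat) {struct c} : nat :=
  match c with
  | CZero => 1
  | CSucc => (head 0 v).+2
  | CProj i => (nth 0 v i).+1
  | CComp f gs =>
      if all (leq 1) (map (fun g => run g s v) gs)
      then run f s (map predn (map (fun g => run g s v) gs)) else 0
  | CPrec f g =>
      if v is n :: w then
        iteri n (fun i z => if z == 0 then 0 else run g s [:: i, z.-1 & w]) (run f s w)
      else 0
  | CMu f => (iteri s (mu_step (fun m => run f s (m :: v))) 0).-1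
  end.

Lemma mu_stepP h s n :
  (iteri s (mu_step h) 0 = n.+2) <->
  [/\ n < s, h n = 1 & forall m, m < n -> 1 < h m].
Proof.
elim: s => [|s IH] /=; first by split=> // -[].
have H0 : iteri s (mu_step h) 0 = 0 <-> (forall m, m < s -> 1 < h m).
  elim: s {IH} => [|s IH] /=; first by split.
  rewrite /mu_step; case: eqP => [E|E].
    case: eqP => E1; first by split=> // /(_ s (ltnSn s)); lia.
    case: eqP => E2; first by split=> // /(_ s (ltnSn s)); lia.
    split=> // _ m; rewrite ltnS leq_eqVlt => /orP[/eqP->|]; [lia|exact: (IH.1 E)].
  by split=> // H; case: E; apply/IH => m hm; apply: H; lia.
rewrite {1}/mu_step; case: eqP => [E|E].
  have {}H0 := H0.1 E; case: eqP => E1.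
    split=> // -[ns h1 hm].
    have [/H0|hns] := ltnP n s; [lia|have : n = s by lia]; by move=> ?; subst; lia.
  case: eqP => E2; split.
  - by case=> <-; split.
  - case=> ns h1 hm; congr (_.+2); have [/H0|] := ltnP n s; lia.
  - by [].
  - case=> ns h1 hm; have [/H0|hns] := ltnP n s; [lia|have : n = s by lia]; by move=> ?; subst; lia.
split.
  by move/IH => [ns h1 hm]; split=> //; lia.
case=> ns h1 hm; apply/IH; split=> //.
by have [//|hns] := ltnP n s; case: E; apply/H0 => m hms; apply: hm; lia.
Qed.

Lemma runS c s s' v y : s <= s' -> run c s v = y.+1 -> run c s' v = y.+1.
Proof.
move=> ss'; elim/code_nested_ind: c v y => //=.
- move=> f gs IHf IHgs v y.
  have E : all (leq 1) (map (fun g => run g s v) gs) ->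
     map (fun g => run g s' v) gs = map (fun g => run g s v) gs.
    elim: gs IHgs => //= g gs IH [Hg Hgs] /andP[g1 gs1]; rewrite IH //; congr cons.
    by case E: (run g s v) g1 => // _; apply: Hg.
  by case: ifP => // H; rewrite E // H; apply: IHf.
- move=> f g IHf IHg [//|n w] y.
  elim: n y => /= [|n IH] y; first exact: IHf.
  case: ifP => // + H; case E: (iteri n _ _) H => [//|z] H _.
  by rewrite (IH _ E) /=; apply: IHg.
- move=> f IHf v y.
  case E: (iteri s _ _) => [//|z] /= zy; subst z; move: E.
  move=> /mu_stepP[ys h1 hm]; suff -> : iteri s' (mu_step (fun m => run f s' (m :: v))) 0 = y.+2 by [].
  apply/mu_stepP; split; [lia|exact: IHf|move=> m my].
  by move: (hm m my); case E: (run f s (m :: v)) => [|[|k]] // _; rewrite (IHf _ _ E).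
Qed.

(** A single cutoff for the finitely many values below a least zero; needed for [CMu] in [evalP]. *)
Lemma run_uniform (h : nat -> seq nat) c n (P : nat -> nat -> Prop) :
  (forall m, m < n -> exists s y, run c s (h m) = y.+1 /\ P m y) ->
  exists s, forall m, m < n -> exists y, run c s (h m) = y.+1 /\ P m y.
Proof.
elim: n => [|n IH] H; first by exists 0.
have [|s Hs] := IH; first by move=> m mn; apply: H; lia.
have [s' [y [Hy Py]]] := H n (ltnSn n).
exists (maxn s s') => m; rewrite ltnS leq_eqVlt => /orP[/eqP->|/Hs [z [Hz Pz]]].
  by exists y; split=> //; apply: runS Hy; exact: leq_maxr.
by exists z; split=> //; apply: runS Hz; exact: leq_maxl.
Qed.

Lemma evalP c v y : eval c v y <-> exists s, run c s v = y.+1.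
Proof.
elim/code_nested_ind: c v y => /=.
- move=> v y; split=> [H|[s [<-]]]; last exact: ev_zero.
  by exists 0; inversion H.
- move=> v y; split=> [H|[s [<-]]]; last exact: ev_succ.
  by exists 0; inversion H.
- move=> i v y; split=> [H|[s [<-]]]; last exact: ev_proj.
  by exists 0; inversion H.
- move=> f gs IHf IHgs v y; split.
    move=> H; inversion H as [| | |f' gs' v' ws y' Hws Hy| | |]; subst.
    have [s [Hs1 Hs2]] : exists s, all (leq 1) (map (fun g => run g s v) gs) /\
        map predn (map (fun g => run g s v) gs) = ws.
      elim: gs IHgs ws Hws {H Hy} => /= [|g gs IH] IHgs ws Hws.
        by exists 0; inversion Hws.
      inversion Hws as [|g' gs' v' z zs Hz Hzs]; subst.
      have [s [Hs1 Hs2]] := IH IHgs.2 _ Hzs.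
      have [s' Hs'] := (IHgs.1 v z).1 Hz.
      exists (maxn s s'); rewrite (runS (leq_maxr _ _) Hs') /=.
      have -> : [seq run g0 (maxn s s') v | g0 <- gs] = [seq run g0 s v | g0 <- gs].
        elim: gs Hs1 {IHgs IH Hws Hzs Hs2} => //= g1 gs IH /andP[H1 H2]; rewrite IH //; congr cons.
        case E: (run g1 s v) H1 => [//|k] _.
        by apply: runS E; exact: leq_maxl.
      by rewrite Hs1 Hs2.
    have [s' Hs'] := (IHf ws y).1 Hy.
    exists (maxn s s').
    have -> : [seq run g0 (maxn s s') v | g0 <- gs] = [seq run g0 s v | g0 <- gs].
      elim: gs Hs1 {H IHgs Hws Hs2} => //= g1 gs IH /andP[H1 H2]; rewrite IH //; congr cons.
      case E: (run g1 s v) H1 => [//|k] _.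
      by apply: runS E; exact: leq_maxl.
    by rewrite Hs1 Hs2; apply: runS Hs'; exact: leq_maxr.
  move=> [s]; case: ifP => // Hall Hy.
  apply: (@ev_comp _ _ _ (map predn (map (fun g => run g s v) gs))); last by apply/IHf; exists s.
  elim: gs IHgs Hall {Hy} => /= [|g gs IH] IHgs H; first exact: evs_nil.
  case/andP: H => H1 H2; apply: evs_cons; last exact: IH IHgs.2 H2.
  by apply/IHgs.1; exists s; case: (run g s v) H1.
- move=> f g IHf IHg v y; split.
    case: v => [|n w] H; first by inversion H.
    elim: n y H => [|n IH] y H.
      inversion H as [| | | |f' g' w' y' Hy| |]; subst.
      exact: (IHf w y).1.
    inversion H as [| | | | |f' g' n' w' z y' Hz Hy|]; subst.
    have [s Hs] := IH _ Hz; have [s' Hs'] := (IHg _ y).1 Hy.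
    exists (maxn s s').
    have /= := @runS (CPrec f g) s (maxn s s') (n :: w) z (leq_maxl _ _) Hs => -> /=.
    by apply: runS Hs'; exact: leq_maxr.
  move=> [s]; case: v => [//|n w].
  elim: n y => /= [|n IH] y H; first by apply: ev_prec0; apply/IHf; exists s.
  case E: (iteri _ _ _) H => [//|z] /= H.
  apply: (@ev_precS _ _ _ _ z); first exact: IH.
  by apply/IHg; exists s.
- move=> f IHf v y; split.
    move=> H; inversion H as [| | | | | |f' v' n H0 Hm]; subst.
    have [s Hs] := (IHf (y :: v) 0).1 H0.
    have [|s' Hs'] := @run_uniform (fun m => m :: v) f y (fun _ k => 0 < k).
      move=> m my; have [k /IHf[s0 Hs0]] := Hm m my.
      by exists s0, k.+1.
    exists (maxn y.+1 (maxn s s')).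
    suff -> : iteri (maxn y.+1 (maxn s s')) (mu_step (fun m => run f (maxn y.+1 (maxn s s')) (m :: v))) 0 = y.+2 by [].
    apply/mu_stepP; split; first exact: leq_maxl.
      by apply: runS Hs; rewrite !leq_max leqnn orbT.
    move=> m /Hs'[k [Hk k0]]; rewrite (@runS f s' _ _ k) //.
    by rewrite !leq_max leqnn !orbT.
  move=> [s]; case E: (iteri s _ _) => [//|z] /= zy; subst z; move: E.
  move=> /mu_stepP[ys h1 hm]; apply: ev_mu; first by apply/IHf; exists s.
  move=> m my; move: (hm m my); case E: (run f s (m :: v)) => [|[|k]] // _.
  by exists k; apply/IHf; exists s.
Qed.

Lemma eval_inj c v y y' : eval c v y -> eval c v y' -> y = y'.
Proof.
move=> /evalP[s Hs] /evalP[s' Hs'].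
move: (runS (leq_maxl s s') Hs) (runS (leq_maxr s s') Hs') => -> [] //.
Qed.

(** * Computable functions *)

(* Arity [k] only: a code may behave differently on lists of other lengths. *)
Definition cf (k : nat) (f : seq nat -> nat) : Prop :=
  exists c, forall v, size v = k -> eval c v (f v).

Lemma cf_ext k f g : (forall v, size v = k -> f v = g v) -> cf k f -> cf k g.
Proof. by move=> E [c Hc]; exists c => v Hv; rewrite -E //; exact: Hc. Qed.

Lemma cf_nth k i : cf k (fun v => nth 0 v i).
Proof. by exists (CProj i) => v _; exact: ev_proj. Qed.

Lemma cf_map k f (hs : seq (seq nat -> nat)) :
  cf (size hs) f -> (forall i, i < size hs -> cf k (nth (fun _ => 0) hs i)) ->
  cf k (fun v => f [seq h v | h <- hs]).
Proof.
move=> [c Hc] H.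
have [cs Hcs] : exists cs, forall v, size v = k -> evals cs v [seq h v | h <- hs].
  elim: hs {Hc} H => [|h hs IH] H; first by exists [::] => v _; exact: evs_nil.
  have [cs Hcs] := IH (fun i => H i.+1).
  have [c0 Hc0] := H 0 isT.
  by exists (c0 :: cs) => v Hv /=; apply: evs_cons; [exact: Hc0|exact: Hcs].
exists (CComp c cs) => v Hv; apply: ev_comp (Hcs v Hv) _.
by apply: Hc; rewrite size_map.
Qed.

Lemma cf_map_ext k f (hs : seq (seq nat -> nat)) g :
  (forall v, size v = k -> f [seq h v | h <- hs] = g v) ->
  cf (size hs) f -> (forall i, i < size hs -> cf k (nth (fun _ => 0) hs i)) -> cf k g.
Proof. by move=> E Hf Hh; apply: cf_ext E _; exact: cf_map. Qed.

Lemma cf_behead k f : cf k f -> cf k.+1 (fun u => f (behead u)).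
Proof.
move=> Hf; pose hs := mkseq (fun i (u : seq nat) => nth 0 u i.+1) k.
apply: (@cf_map_ext _ f hs).
  move=> [//|x v] /= [Hv]; congr f; rewrite /hs -map_comp /=.
  by rewrite -[RHS](mkseq_nth 0) Hv.
  by rewrite size_mkseq.
rewrite size_mkseq => i ik.
by rewrite nth_mkseq //; exact: cf_nth.
Qed.

Lemma cf_const k n : cf k (fun _ => n).
Proof.
elim: n => [|n [c Hc]]; first by exists CZero => v _; exact: ev_zero.
exists (CComp CSucc [:: c]) => v Hv.
by apply: (@ev_comp _ _ _ [:: n]); [apply: evs_cons (Hc v Hv) _; exact: evs_nil|exact: (@ev_succ [:: n])].
Qed.

Lemma cf_succ k f : cf k f -> cf k (fun v => (f v).+1).
Proof.
move=> [c Hc]; exists (CComp CSucc [:: c]) => v Hv.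
by apply: (@ev_comp _ _ _ [:: f v]); [apply: evs_cons (Hc v Hv) _; exact: evs_nil|exact: (@ev_succ [:: f v])].
Qed.

(** [CPrec] recurses on the head of its argument list, so the number of iterations is put in front
    of a copy of the arguments made of projections. *)
Lemma cf_iteri k n f g : cf k n -> cf k f ->
  cf k.+2 (fun u => g (nth 0 u 0) (nth 0 u 1) (behead (behead u))) ->
  cf k (fun v => iteri (n v) (fun i z => g i z v) (f v)).
Proof.
move=> Hn [cf0 Hf] [cg Hg].
have H : cf k.+1 (fun u => iteri (nth 0 u 0) (fun i z => g i z (behead u)) (f (behead u))).
  exists (CPrec cf0 cg) => -[//|m v] /= [Hv].
  elim: m => [|m IH] /=; first by apply: ev_prec0; exact: Hf.
  apply: ev_precS IH _; exact: (Hg [:: _, _ & v] (f_equal (fun k => k.+2) Hv)).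
pose hs := n :: mkseq (fun i (u : seq nat) => nth 0 u i) k.
apply: (@cf_map_ext _ (fun u => iteri (nth 0 u 0) (fun i z => g i z (behead u))
     (f (behead u))) hs).
  move=> v Hv /=.
  suff -> : [seq h v | h <- mkseq (fun i u => nth 0 u i) k] = v by [].
  by rewrite -map_comp /= -[RHS](mkseq_nth 0) Hv.
  by rewrite /= ?size_mkseq ?size_map; exact: H.
move=> [|i] /=; rewrite ?size_mkseq // => ik.
by rewrite nth_mkseq //; exact: cf_nth.
Qed.

Definition cf1 f := cf 1 (fun v => f (nth 0 v 0)).
Definition cf2 f := cf 2 (fun v => f (nth 0 v 0) (nth 0 v 1)).
Definition cf3 f := cf 3 (fun v => f (nth 0 v 0) (nth 0 v 1) (nth 0 v 2)).
Definition cf4 f := cf 4 (fun v => f (nth 0 v 0) (nth 0 v 1) (nth 0 v 2) (nth 0 v 3)).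

Lemma cf_app1 f : cf1 f -> forall k g, cf k g -> cf k (fun v => f (g v)).
Proof. by move=> Hf k g Hg; apply: (@cf_map k (fun v => f (nth 0 v 0)) [:: g] Hf) => -[|i]. Qed.
Lemma cf_app2 f : cf2 f -> forall k g h, cf k g -> cf k h -> cf k (fun v => f (g v) (h v)).
Proof. by move=> Hf k g h Hg Hh; apply: (@cf_map k (fun v => f (nth 0 v 0) (nth 0 v 1)) [:: g; h] Hf) => -[|[|i]]. Qed.
Lemma cf_app3 f : cf3 f -> forall k g h i, cf k g -> cf k h -> cf k i ->
  cf k (fun v => f (g v) (h v) (i v)).
Proof. by move=> Hf k g h i Hg Hh Hi; apply: (@cf_map k (fun v => f (nth 0 v 0) (nth 0 v 1) (nth 0 v 2)) [:: g; h; i] Hf) => -[|[|[|j]]]. Qed.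
Lemma cf_app4 f : cf4 f -> forall k g h i j, cf k g -> cf k h -> cf k i -> cf k j ->
  cf k (fun v => f (g v) (h v) (i v) (j v)).
Proof.
by move=> Hf k g h i j Hg Hh Hi Hj; apply: (@cf_map k (fun v => f (nth 0 v 0) (nth 0 v 1) (nth 0 v 2) (nth 0 v 3)) [:: g; h; i; j] Hf) => -[|[|[|[|l]]]].
Qed.

(** Inside [cf_iteri], [cf_sum] and [cf_has] the outer arguments sit under [behead]; these forms let
    the hint database reach them. *)
Lemma cf_nth_b k i : cf k (fun v => nth 0 (behead v) i).
Proof. by apply: cf_ext (cf_nth k i.+1) => v _; rewrite nth_behead. Qed.
Lemma cf_nth_bb k i : cf k (fun v => nth 0 (behead (behead v)) i).
Proof. by apply: cf_ext (cf_nth k i.+2) => v _; rewrite !nth_behead. Qed.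
Lemma cf_nth_bbb k i : cf k (fun v => nth 0 (behead (behead (behead v))) i).
Proof. by apply: cf_ext (cf_nth k i.+3) => v _; rewrite !nth_behead. Qed.
Lemma cf_nth_bbbb k i : cf k (fun v => nth 0 (behead (behead (behead (behead v)))) i).
Proof. by apply: cf_ext (cf_nth k i.+4) => v _; rewrite !nth_behead. Qed.

Create HintDb cf.
#[global] Hint Resolve cf_const cf_nth cf_nth_b cf_nth_bb cf_nth_bbb cf_nth_bbbb cf_succ : cf.
Ltac cfauto := by eauto 60 with cf nocore.

Lemma cf_add k f g : cf k f -> cf k g -> cf k (fun v => f v + g v).
Proof.
move=> Hf Hg; apply: (@cf_ext _ (fun v => iteri (g v) (fun _ z => z.+1) (f v))).
  by move=> v _; elim: (g v) => [|n /= ->]; rewrite ?addn0 ?addnS.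
by apply: cf_iteri => //; cfauto.
Qed.
#[global] Hint Resolve cf_add : cf.

Lemma cf_pred k f : cf k f -> cf k (fun v => (f v).-1).
Proof.
move=> Hf; apply: (@cf_ext _ (fun v => iteri (f v) (fun i _ => i) 0)).
  by move=> v _; case: (f v).
by apply: cf_iteri => //; cfauto.
Qed.
#[global] Hint Resolve cf_pred : cf.

Lemma cf_sub k f g : cf k f -> cf k g -> cf k (fun v => f v - g v).
Proof.
move=> Hf Hg; apply: (@cf_ext _ (fun v => iteri (g v) (fun _ z => z.-1) (f v))).
  by move=> v _; elim: (g v) => [|n /= ->]; rewrite ?subn0 ?subnS.
by apply: cf_iteri => //; cfauto.
Qed.
#[global] Hint Resolve cf_sub : cf.

Lemma cf_mul k f g : cf k f -> cf k g -> cf k (fun v => f v * g v).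
Proof.
move=> Hf Hg.
apply: (@cf_ext _ (fun v => iteri (g v) (fun _ z => z + f v) 0)).
  by move=> v _; elim: (g v) => [|n /= ->]; rewrite ?muln0 ?mulnS 1?addnC.
apply: (@cf_iteri _ _ _ (fun _ z v => z + f v)) => //; first cfauto.
apply: cf_add; first cfauto.
exact: (cf_behead (cf_behead Hf)).
Qed.
#[global] Hint Resolve cf_mul : cf.

Lemma cf_exp k f g : cf k f -> cf k g -> cf k (fun v => f v ^ g v).
Proof.
move=> Hf Hg.
apply: (@cf_ext _ (fun v => iteri (g v) (fun _ z => z * f v) 1)).
  by move=> v _; elim: (g v) => [|n /= ->]; rewrite ?expn0 ?expnS 1?mulnC.
apply: (@cf_iteri _ _ _ (fun _ z v => z * f v)) => //; first cfauto.
apply: cf_mul; first cfauto.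
exact: (cf_behead (cf_behead Hf)).
Qed.
#[global] Hint Resolve cf_exp : cf.

Lemma cf_leq k f g : cf k f -> cf k g -> cf k (fun v => nat_of_bool (f v <= g v)).
Proof.
move=> Hf Hg; apply: (@cf_ext _ (fun v => 1 - (f v - g v))); last cfauto.
by move=> v _; rewrite /leq; case: (f v - g v).
Qed.
#[global] Hint Resolve cf_leq : cf.
Lemma cf_and k (f g : seq nat -> bool) : cf k f -> cf k g -> cf k (fun v => nat_of_bool (f v && g v)).
Proof.
move=> Hf Hg; apply: (@cf_ext _ (fun v => f v * g v)); last cfauto.
by move=> v _; case: (f v); case: (g v).
Qed.
#[global] Hint Resolve cf_and : cf.
Lemma cf_neg k (f : seq nat -> bool) : cf k f -> cf k (fun v => nat_of_bool (~~ f v)).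
Proof.
move=> Hf; apply: (@cf_ext _ (fun v => 1 - f v)); last cfauto.
by move=> v _; case: (f v).
Qed.
#[global] Hint Resolve cf_neg : cf.
Lemma cf_or k (f g : seq nat -> bool) : cf k f -> cf k g -> cf k (fun v => nat_of_bool (f v || g v)).
Proof.
move=> Hf Hg; apply: (@cf_ext _ (fun v => nat_of_bool (~~ (~~ f v && ~~ g v)))); last cfauto.
by move=> v _; case: (f v); case: (g v).
Qed.
#[global] Hint Resolve cf_or : cf.
Lemma cf_eq k f g : cf k f -> cf k g -> cf k (fun v => nat_of_bool (f v == g v)).
Proof.
move=> Hf Hg; apply: (@cf_ext _ (fun v => nat_of_bool ((f v <= g v) && (g v <= f v)))); last cfauto.
by move=> v _; rewrite eqn_leq.
Qed.
#[global] Hint Resolve cf_eq : cf.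
Lemma cf_if k (b : seq nat -> bool) f g : cf k b -> cf k f -> cf k g ->
  cf k (fun v => if b v then f v else g v).
Proof.
move=> Hb Hf Hg; apply: (@cf_ext _ (fun v => b v * f v + (1 - b v) * g v)); last cfauto.
by move=> v _; case: (b v); rewrite ?mul1n ?mul0n ?addn0.
Qed.
#[global] Hint Resolve cf_if : cf.
Lemma cf_max k f g : cf k f -> cf k g -> cf k (fun v => maxn (f v) (g v)).
Proof. by move=> Hf Hg; rewrite /maxn; cfauto. Qed.
Lemma cf_min k f g : cf k f -> cf k g -> cf k (fun v => minn (f v) (g v)).
Proof. by move=> Hf Hg; rewrite /minn; cfauto. Qed.
#[global] Hint Resolve cf_min cf_max : cf.

Lemma cf_sum k n F : cf k n -> cf k.+1 (fun u => F (nth 0 u 0) (behead u)) ->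
  cf k (fun v => \sum_(0 <= i < n v) F i v).
Proof.
move=> Hn HF; apply: (@cf_ext _ (fun v => iteri (n v) (fun i z => z + F i v) 0)).
  by move=> v _; elim: (n v) => [|m /= ->]; rewrite ?big_nil ?big_nat_recr.
apply: (@cf_iteri _ _ _ (fun i z v => z + F i v)) => //; first cfauto.
apply: cf_add; first cfauto.
pose hs := (fun u => nth 0 u 0) :: mkseq (fun i (u : seq nat) => nth 0 u i.+2) k.
apply: (@cf_map_ext _ (fun u => F (nth 0 u 0) (behead u)) hs).
  move=> [//|x [//|y v]] /= [Hv]; congr F.
  by rewrite -map_comp /= -[RHS](mkseq_nth 0) Hv.
  by rewrite /= ?size_mkseq ?size_map; exact: HF.
move=> [|i] /=; rewrite ?size_mkseq // => ik; first cfauto.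
by rewrite nth_mkseq //; exact: cf_nth.
Qed.

Lemma cf_has k n (P : nat -> seq nat -> bool) : cf k n ->
  cf k.+1 (fun u => nat_of_bool (P (nth 0 u 0) (behead u))) ->
  cf k (fun v => nat_of_bool (has (fun i => P i v) (iota 0 (n v)))).
Proof.
move=> Hn HP; apply: (@cf_ext _ (fun v => nat_of_bool (0 < \sum_(0 <= i < n v) P i v))).
  move=> v _; rewrite /index_iota subn0; congr nat_of_bool.
  elim: (iota _ _) => [|i s IH]; rewrite ?big_nil // big_cons /= -IH.
  by case: (P i v).
by apply: cf_leq; [cfauto|exact: cf_sum].
Qed.

Lemma cf_div k f g : cf k f -> cf k g -> cf k (fun v => f v %/ g v).
Proof.
move=> Hf Hg.
(* The quotient counts the multiples of the divisor up to [f v]; the first factor gives the default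
   0 for division by 0. *)
apply: (@cf_ext _ (fun v => (0 < g v) * \sum_(0 <= i < f v) (i.+1 * g v <= f v))); last first.
  apply: cf_mul; first cfauto.
  apply: (@cf_sum _ _ (fun i v => nat_of_bool (i.+1 * g v <= f v))) => //.
  by apply: cf_leq; [apply: cf_mul; [cfauto|exact: (cf_behead Hg)]|exact: (cf_behead Hf)].
move=> v _; case: (posnP (g v)) => [->|g0]; first by rewrite divn0.
rewrite mul1n /=; under eq_bigr => i _ do rewrite -leq_divRL //.
have : f v %/ g v <= f v by exact: leq_div.
move: (f v %/ g v) => q; elim: (f v) q => [|m IH] q qm.
  by rewrite big_geq //; lia.
rewrite big_nat_recr //=; have [e|] := leqP q m; first by rewrite IH //; lia.
move=> mq; have -> : q = m.+1 by lia.
rewrite addn1; congr _.+1.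
rewrite (eq_big_nat _ _ (F2 := fun=> 1)); last by move=> i /andP[_ im]; rewrite ltnW.
by rewrite sum_nat_const_nat; lia.
Qed.
#[global] Hint Resolve cf_div : cf.
Lemma cf_mod k f g : cf k f -> cf k g -> cf k (fun v => f v %% g v).
Proof.
move=> Hf Hg; apply: (@cf_ext _ (fun v => f v - f v %/ g v * g v)); last cfauto.
by move=> v _; rewrite {1}(divn_eq (f v) (g v)) addKn.
Qed.
#[global] Hint Resolve cf_mod : cf.

Lemma cf_bigmax k n F : cf k n -> cf k.+1 (fun u => F (nth 0 u 0) (behead u)) ->
  cf k (fun v => \max_(0 <= i < n v) F i v).
Proof.
move=> Hn HF; apply: (@cf_ext _ (fun v => iteri (n v) (fun i z => maxn z (F i v)) 0)).
  by move=> v _; elim: (n v) => [|m /= ->]; rewrite ?big_nil ?big_nat_recr.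
apply: (@cf_iteri _ _ _ (fun i z v => maxn z (F i v))) => //; first cfauto.
apply: cf_max; first cfauto.
pose hs := (fun u => nth 0 u 0) :: mkseq (fun i (u : seq nat) => nth 0 u i.+2) k.
apply: (@cf_map_ext _ (fun u => F (nth 0 u 0) (behead u)) hs).
  move=> [//|x [//|y v]] /= [Hv]; congr F.
  by rewrite -map_comp /= -[RHS](mkseq_nth 0) Hv.
  by rewrite /= ?size_mkseq ?size_map; exact: HF.
move=> [|i] /=; rewrite ?size_mkseq // => ik; first cfauto.
by rewrite nth_mkseq //; exact: cf_nth.
Qed.

(** For a fixed code the cut-off evaluation is itself computable, so later codes can inspect the
    stages of [U], of X and of a test. *)
Lemma cf_run c k : cf k.+1 (fun u => run c (nth 0 u 0) (behead u)).
Proof.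
elim/code_nested_ind: c k => [||i|f gs IHf IHgs|f g IHf IHg|f IHf] k /=.
- cfauto.
- apply: (@cf_ext _ (fun u => (nth 0 u 1).+2)); last cfauto.
  by move=> [//|x [|y v]].
- cfauto.
- apply: cf_if; last exact: cf_const.
    elim: gs IHgs => [|g gs IH] /= IHgs; first exact: cf_const.
    by apply: cf_and; [apply: cf_leq; [cfauto|exact: IHgs.1]|exact: IH IHgs.2].
  pose hs := (fun u => nth 0 u 0) ::
    map (fun g (u : seq nat) => (run g (nth 0 u 0) (behead u)).-1) gs.
  apply: (@cf_map_ext _ (fun u => run f (nth 0 u 0) (behead u)) hs).
    by move=> u _ /=; rewrite -!map_comp.
    by rewrite /= ?size_mkseq ?size_map; exact: IHf.
  move=> [|i] /=; rewrite ?size_map; first by move=> _; cfauto.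
  rewrite ltnS => igs; rewrite (nth_map CZero) //; apply: cf_pred.
  elim: gs i IHgs igs {hs} => //= g gs IH [|i] IHgs igs; first exact: IHgs.1.
  exact: IH IHgs.2 igs.
- case: k => [|k].
    by apply: cf_ext (cf_const 1 0) => -[//|x [|]].
  apply: (@cf_ext _ (fun u => iteri (nth 0 u 1)
     (fun i z => if z == 0 then 0 else run g (nth 0 u 0) [:: i, z.-1 & behead (behead u)])
     (run f (nth 0 u 0) (behead (behead u))))).
    by move=> [//|s [//|n w]].
  apply: (@cf_iteri _ _ _ (fun i z u => if z == 0 then 0 else run g (nth 0 u 0) [:: i, z.-1 & behead (behead u)])).
  + cfauto.
  + pose hs := (fun u => nth 0 u 0) :: mkseq (fun i (u : seq nat) => nth 0 u i.+2) k.
    apply: (@cf_map_ext _ (fun u => run f (nth 0 u 0) (behead u)) hs).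
      move=> [//|x [//|y v]] /= [Hv]; congr run.
      by rewrite -map_comp /= -[RHS](mkseq_nth 0) Hv.
      by rewrite /= ?size_mkseq ?size_map; exact: IHf.
    move=> [|i] /=; rewrite ?size_mkseq // => ik; first cfauto.
    by rewrite nth_mkseq //; exact: cf_nth.
  + apply: cf_if; [cfauto|cfauto|].
    pose hs := [:: (fun u => nth 0 u 2), (fun u => nth 0 u 0), (fun u => (nth 0 u 1).-1) &
       mkseq (fun i (u : seq nat) => nth 0 u i.+4) k].
    apply: (@cf_map_ext _ (fun u => run g (nth 0 u 0) (behead u)) hs).
      move=> [//|i [//|z [//|s [//|n w]]]] /= [Hw]; congr run.
      by rewrite -map_comp /=; congr [:: _, _ & _]; rewrite -[RHS](mkseq_nth 0) Hw.
      by rewrite /= ?size_mkseq ?size_map; exact: IHg.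
    move=> [|[|[|i]]] /=; rewrite ?size_mkseq // => ik; try cfauto.
    by rewrite nth_mkseq //; exact: cf_nth.
- apply: cf_pred.
  apply: (@cf_iteri _ _ _ (fun m acc u => mu_step (fun m => run f (nth 0 u 0) (m :: behead u)) m acc)).
  + cfauto.
  + cfauto.
  + have H : cf k.+3 (fun u => run f (nth 0 u 2) (nth 0 u 0 :: behead (behead (behead u)))).
      pose hs := [:: (fun u => nth 0 u 2), (fun u => nth 0 u 0) &
         mkseq (fun i (u : seq nat) => nth 0 u i.+3) k].
      apply: (@cf_map_ext _ (fun u => run f (nth 0 u 0) (behead u)) hs).
        move=> [//|i [//|z [//|s w]]] /= [Hw]; congr run; congr cons.
        by rewrite -map_comp /=; rewrite -[RHS](mkseq_nth 0) Hw.
        by rewrite /= ?size_mkseq ?size_map; exact: IHf.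
      move=> [|[|i]] /=; rewrite ?size_mkseq // => ik; try cfauto.
      by rewrite nth_mkseq //; exact: cf_nth.
    apply: (@cf_ext _ (fun u => let h := run f (nth 0 u 2) (nth 0 u 0 :: behead (behead (behead u))) in
       if nth 0 u 1 == 0 then (if h == 0 then 1 else if h == 1 then (nth 0 u 0).+2 else 0) else nth 0 u 1)).
      by move=> [//|i [//|z [//|s w]]].
    cfauto.
Qed.

Lemma cf_run1 c : cf2 (fun s m => run c s [:: m]).
Proof. by apply: cf_ext (cf_run c 1) => -[//|s [//|m []]]. Qed.
Lemma cf_run2 c : cf3 (fun s m n => run c s [:: m; n]).
Proof. by apply: cf_ext (cf_run c 2) => -[//|s [//|m [//|n []]]]. Qed.

Lemma digitE b (x : nat -> nat) n i : (forall j, x j < b) -> i < n ->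
  (\sum_(0 <= j < n) x j * b ^ j) %/ b ^ i %% b = x i.
Proof.
move=> xb; have b0 : 0 < b by apply: leq_ltn_trans (xb 0).
have lt m : \sum_(0 <= j < m) x j * b ^ j < b ^ m.
  elim: m => [|m IH]; first by rewrite big_geq.
  rewrite big_nat_recr //= expnS; apply: leq_trans (_ : b ^ m + x m * b ^ m <= _).
    by rewrite ltn_add2r.
  by rewrite -mulSn leq_mul2r xb orbT.
elim: n => // n IH; rewrite ltnS leq_eqVlt big_nat_recr //= => /orP[/eqP->|lin].
  by rewrite addnC divnMDl ?expn_gt0 ?b0 // divn_small // addn0 modn_small.
rewrite -(IH lin) addnC -(subnK (ltnW lin)) expnD mulnA divnMDl ?expn_gt0 ?b0 //.
have -> : n - i = (n - i).-1.+1 by lia.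
by rewrite expnSr mulnA modnMDl.
Qed.

(* A two-dimensional recursion is computed row by row, a row being coded by its
   digits in a large base. *)
Lemma cf_table (f : nat -> nat -> nat -> nat -> nat) (T : nat -> nat -> nat) : cf4 f ->
  (forall t, T 0 t = 0) -> (forall n, T n 0 = 0) ->
  (forall n t, T n.+1 t.+1 = f n t (T n t.+1) (T n.+1 t)) ->
  (forall n t, T n t <= t) -> cf2 T.
Proof.
move=> Hf T0 Tn0 TS Tt.
pose dig b x i := x %/ b ^ i %% b.
(* The row at time [u.+1]: [x] codes the row at time [u], and [acc] holds the digits found so far,
   starting with the digit 0 given by [T0]. *)
pose rowS b n u x := iteri n (fun j acc =>
   acc + f j u (dig b acc j) (dig b x j.+1) * b ^ j.+1) 0.
pose row b n t := iteri t (fun u x => rowS b n u x) 0.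
have E b n t : t < b -> row b n t = \sum_(0 <= j < n.+1) T j t * b ^ j.
  elim: t => [|t IH] tb; first by rewrite big1 // => j _; rewrite Tn0.
  rewrite /row /= -/(row b n t) IH; last by lia.
  suff H m : m <= n -> rowS b m t (\sum_(0 <= j < n.+1) T j t * b ^ j) =
     \sum_(0 <= j < m.+1) T j t.+1 * b ^ j by exact: H.
  elim: m => [|m IHm] mn; first by rewrite big_nat1 T0.
  rewrite /rowS /= -/(rowS b m t _) IHm 1?ltnW // [RHS]big_nat_recr //=.
  rewrite /dig !digitE ?TS // => j; apply: leq_ltn_trans (Tt _ _) _ => //; lia.
(* Entries up to time t are at most t, so base t + 1 serves for all the rows involved. *)
apply: (@cf_ext _ (fun v => dig (nth 0 v 1).+1 (row (nth 0 v 1).+1 (nth 0 v 0) (nth 0 v 1)) (nth 0 v 0))).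
  move=> v _; rewrite E // /dig digitE // => j; rewrite ltnS; exact: Tt.
have Hd k b x i : cf k b -> cf k x -> cf k i -> cf k (fun v => dig (b v) (x v) (i v)).
  by rewrite /dig; cfauto.
apply: (Hd); [cfauto| |cfauto].
apply: (@cf_iteri _ _ _ (fun u x v => rowS (nth 0 v 1).+1 (nth 0 v 0) u x)); [cfauto|cfauto|].
apply: (@cf_iteri _ _ _ (fun j acc u => acc + f j (nth 0 u 0)
   (dig (nth 0 (behead (behead u)) 1).+1 acc j)
   (dig (nth 0 (behead (behead u)) 1).+1 (nth 0 u 1) j.+1)
   * (nth 0 (behead (behead u)) 1).+1 ^ j.+1)); [cfauto|cfauto|].
apply: cf_add; first cfauto.
apply: cf_mul; last cfauto.
by apply: (cf_app4 Hf); [cfauto|cfauto| |]; apply: Hd; cfauto.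
Qed.

(** * Strings and weights *)

(** A string is handled as its length l and its value v < 2^l, which turns sets of strings into
    predicates on numbers; [str] rebuilds the string. *)
Definition bval (s : seq bool) : nat := foldl (fun acc (b : bool) => acc.*2 + b) 0 s.
Definition str (l v : nat) : seq bool := mkseq (fun i => odd (v %/ 2 ^ (l - i.+1))) l.

Lemma foldl_bits a s :
  foldl (fun acc (b : bool) => acc.*2 + b) a s = a * 2 ^ size s + bval s.
Proof.
rewrite /bval; elim: s a => [|b s IH] a /=; first by rewrite muln1 addn0.
by rewrite IH [in RHS]IH expnS -!muln2 !mulnDl mul0n add0n mulnA addnA.
Qed.

Lemma bval_cat s t : bval (s ++ t) = bval s * 2 ^ size t + bval t.
Proof. by rewrite {1}/bval foldl_cat foldl_bits. Qed.

Lemma bval_rcons s b : bval (rcons s b) = (bval s).*2 + b.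
Proof. by rewrite /bval foldl_rcons. Qed.

Lemma bval_lt s : bval s < 2 ^ size s.
Proof.
elim/last_ind: s => // s b IH; rewrite bval_rcons size_rcons expnS.
by case: b; lia.
Qed.

Lemma encE s : enc s = (2 ^ size s + bval s).-1.
Proof. by rewrite /enc foldl_bits mul1n. Qed.

Lemma size_str l v : size (str l v) = l. Proof. exact: size_mkseq. Qed.

Lemma strS l v : str l.+1 v = rcons (str l v./2) (odd v).
Proof.
rewrite /str mkseqS subnn divn1; congr rcons.
apply/eq_in_map => i; rewrite mem_iota add0n => /andP[_ il].
by rewrite -divn2 -divnMA -expnS; congr (odd (_ %/ 2 ^ _)); lia.
Qed.

Lemma str_val s : str (size s) (bval s) = s.
Proof.
elim/last_ind: s => // s b IH; rewrite size_rcons strS bval_rcons.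
have -> : ((bval s).*2 + b)./2 = bval s by case: b; lia.
by rewrite IH; congr rcons; rewrite oddD odd_double; case: b.
Qed.

Lemma val_str l v : v < 2 ^ l -> bval (str l v) = v.
Proof.
elim: l v => [|l IH] v vl; first by case: v vl.
rewrite strS bval_rcons IH; last by move: vl; rewrite expnS; lia.
by rewrite addnC odd_double_half.
Qed.

Lemma enc_str l v : v < 2 ^ l -> enc (str l v) = (2 ^ l + v).-1.
Proof. by move=> vl; rewrite encE size_str val_str. Qed.

Lemma enc_inj s t : enc s = enc t -> s = t.
Proof.
rewrite !encE => E; have {}E : 2 ^ size s + bval s = 2 ^ size t + bval t.
  by have := expn_gt0 2 (size s); have := expn_gt0 2 (size t); lia.
have H u w : 2 ^ size u + bval u = 2 ^ size w + bval w -> size u <= size w.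
  move=> e; rewrite leqNgt; apply/negP => lt.
  have := bval_lt w; have : 2 ^ (size w).+1 <= 2 ^ size u by rewrite leq_exp2l.
  by rewrite expnS; lia.
have Es : size s = size t by apply/eqP; rewrite eqn_leq !H.
by rewrite -(str_val s) -(str_val t) Es; congr str; move: E; rewrite Es; lia.
Qed.

Lemma enc_surj y : exists t, enc t = y.
Proof.
pose l := trunc_log 2 y.+1; have /andP[h1 h2] := trunc_log_bounds (isT : 1 < 2) (isT : 0 < y.+1).
have vl : y.+1 - 2 ^ l < 2 ^ l by move: h2 h1; rewrite -/l expnS; lia.
by exists (str l (y.+1 - 2 ^ l)); rewrite enc_str //; move: h1; rewrite -/l; lia.
Qed.

Lemma prefix_str w s :
  prefix w s = (size w <= size s) && (bval s %/ 2 ^ (size s - size w) == bval w).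
Proof.
apply/prefixP/andP => [[u ->]|[ws /eqP E]].
  rewrite size_cat leq_addr addKn bval_cat divnMDl ?expn_gt0 // divn_small ?addn0 //.
  exact: bval_lt.
exists (drop (size w) s); rewrite -{1}(cat_take_drop (size w) s); congr cat.
have sz : size (take (size w) s) = size w by rewrite size_take_min; apply/minn_idPl.
rewrite -[LHS]str_val -[RHS]str_val sz -E; congr str.
rewrite -{2}(cat_take_drop (size w) s) bval_cat size_drop divnMDl ?expn_gt0 //.
rewrite divn_small ?addn0 //; rewrite -size_drop; exact: bval_lt.
Qed.

Lemma str_cat s l v : v < 2 ^ l -> s ++ str l v = str (size s + l) (bval s * 2 ^ l + v).
Proof.
by move=> vl; rewrite -[LHS]str_val size_cat bval_cat size_str val_str.
Qed.

Lemma card_tuples (k : nat) (P : pred (seq bool)) :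
  #|[set s : k.-tuple bool | P (tval s)]| = \sum_(0 <= v < 2 ^ k) P (str k v).
Proof.
rewrite big_mkord -sum1_card.
have sz (v : 'I_(2 ^ k)) : size (str k v) == k by rewrite size_str.
pose f (v : 'I_(2 ^ k)) : k.-tuple bool := Tuple (sz v).
have vt (s : k.-tuple bool) : bval s < 2 ^ k by rewrite -{2}(size_tuple s) bval_lt.
pose g (s : k.-tuple bool) : 'I_(2 ^ k) := Ordinal (vt s).
rewrite (reindex f) /=; last first.
  exists g => [v _|s _]; apply/val_inj => /=; first exact: val_str.
  by rewrite -{1}(size_tuple s) str_val.
under eq_bigl => v do rewrite inE.
by rewrite big_mkcond; apply: eq_bigr => v _ /=; case: (P _).
Qed.

Definition count_strings (Q : nat -> nat -> Prop) l : nat := \sum_(0 <= v < 2 ^ l) `[< Q l v >].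
(** Weight in units of 2^-s of the strings of length at most s present at stage s; the cut in length
    makes it a finite, computable sum. *)
Definition weight_num (q : nat -> nat -> nat -> bool) s : nat :=
  \sum_(0 <= l < s.+1) (\sum_(0 <= v < 2 ^ l) q s l v) * 2 ^ (s - l).
Definition stage_limit (q : nat -> nat -> nat -> bool) l v := exists s, q s l v.
Definition nondec_stage (q : nat -> nat -> nat -> bool) :=
  forall s s' l v, s <= s' -> q s l v -> q s' l v.
(** The equation with [%/] says that the string (l, v) is a prefix of (m, w), as in [prefix_str]. *)
Definition prefix_free_set (Q : nat -> nat -> Prop) := forall l v m w,
  l <= m -> w < 2 ^ m -> Q l v -> Q m w -> w %/ 2 ^ (m - l) = v -> l = m.

Section Weights.
Local Open Scope ring_scope.
Variable R : realType.
Implicit Types (Q P : nat -> nat -> Prop) (q : nat -> nat -> nat -> bool).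

Definition wseq Q : nat -> R := fun l => (count_strings Q l)%:R / 2 ^+ l.
Definition meas Q : R := limn (series (wseq Q)).
Definition weight q s : R := (weight_num q s)%:R / 2 ^+ s.

Lemma pow2_gt0 n : 0 < (2 : R) ^+ n. Proof. exact: exprn_gt0. Qed.
Lemma pow2_neq0 n : (2 : R) ^+ n != 0. Proof. by rewrite gt_eqF ?pow2_gt0. Qed.
Lemma natrX2 n : (2 ^ n)%:R = 2 ^+ n :> R. Proof. by rewrite natrX. Qed.

Lemma halting_probE (U : pfun) X : halting_prob R U X =
  meas (fun l v => exists t, U (str l v) = Some t /\ X t).
Proof.
rewrite /halting_prob /meas; congr (limn (series _)); apply/funext => k.
rewrite /wseq /count_strings -(card_tuples k (fun s => `[< exists t, U s = Some t /\ X t >])).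
rewrite big_const iter_addr addr0 -[LHS]mulr_natl; congr (_%:R * _).
by apply: eq_card => s; rewrite inE.
Qed.

Lemma sum_div_nat (f : nat -> nat) l k :
  (\sum_(0 <= v < 2 ^ (l + k)) f (v %/ 2 ^ k) = 2 ^ k * \sum_(0 <= v < 2 ^ l) f v)%N.
Proof.
rewrite expnD; elim: (2 ^ l)%N => [|n IH]; first by rewrite mul0n !big_geq ?muln0.
rewrite big_nat_recr //= mulnDr -IH mulSn addnC (big_cat_nat (n := n * 2 ^ k)) //=; last lia.
congr addn; rewrite -{1}[(n * _)%N]add0n big_addn addKn.
rewrite (eq_big_nat _ _ (F2 := fun=> f n)).
  by rewrite sum_nat_const_nat subn0.
by move=> i /andP[_ ik]; rewrite addnC divnMDl ?expn_gt0 // divn_small ?addn0.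
Qed.

(** A string of length n has at most one prefix in [Q]; exchanging the sums counts each such string
    at most once. *)
Lemma kraft Q n : prefix_free_set Q ->
  (\sum_(0 <= l < n) count_strings Q l * 2 ^ (n - l) <= 2 ^ n)%N.
Proof.
move=> pf.
have -> : (\sum_(0 <= l < n) count_strings Q l * 2 ^ (n - l) =
  \sum_(0 <= l < n) \sum_(0 <= v < 2 ^ n) `[< Q l (v %/ 2 ^ (n - l)) >])%N.
  apply: eq_big_nat => l /andP[_ ln].
  have {2}-> : n = (l + (n - l))%N by lia.
  by rewrite (sum_div_nat (fun v => `[< Q l v >] : nat)) mulnC.
rewrite exchange_big /=; apply: (@leq_trans (\sum_(0 <= v < 2 ^ n) 1)%N); last first.
  by rewrite sum_nat_const_nat; lia.
rewrite !big_mkord; apply: leq_sum => v _.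
have [[i]|/forallNP H] := pselect (exists i : 'I_n, Q i (v %/ 2 ^ (n - i))%N); last first.
  by rewrite big_mkord big1 // => i _; case: asboolP => // Hi; case: (H i).
move=> Qi; rewrite big_mkord (bigD1 i) //= big1 => [|j ji].
  by rewrite addn0; case: asboolP.
case: asboolP => // Qj; case/eqP: ji; apply/val_inj => /=.
have lt (k : 'I_n) : (v %/ 2 ^ (n - k) < 2 ^ k)%N.
  rewrite ltn_divLR ?expn_gt0 // -expnD; have -> : (k + (n - k) = n)%N by have := ltn_ord k; lia.
  exact: ltn_ord.
have H (k m : 'I_n) : (k <= m)%N -> Q k (v %/ 2 ^ (n - k))%N -> Q m (v %/ 2 ^ (n - m))%N -> k = m :> nat.
  move=> km Qk Qm; apply: (pf _ _ _ _ km (lt m) Qk Qm).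
  rewrite -divnMA -expnD; congr (_ %/ 2 ^ _)%N.
  by have := ltn_ord m; lia.
by case/orP: (leq_total i j) => le; [rewrite (H i j)|rewrite (H j i)].
Qed.

Lemma wseq_ge0 Q l : 0 <= wseq Q l.
Proof. by rewrite divr_ge0 ?ler0n // ltW ?pow2_gt0. Qed.

Definition bounded_meas Q := forall n, series (wseq Q) n <= 1.

Lemma pf_bounded Q : prefix_free_set Q -> bounded_meas Q.
Proof.
move=> pf n; rewrite -(ler_pM2r (pow2_gt0 n)) mul1r -natrX2.
rewrite /series /= big_distrl /=.
apply: le_trans (_ : (\sum_(0 <= l < n) count_strings Q l * 2 ^ (n - l))%N%:R <= _); last first.
  by rewrite ler_nat; exact: kraft.
rewrite natr_sum le_eqVlt; apply/orP; left; apply/eqP; apply: eq_big_nat => l /andP[_ ln].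
have -> : (2 ^ n)%:R = 2 ^+ (n - l) * 2 ^+ l :> R by rewrite natrX2 -exprD subnK // ltnW.
by rewrite /wseq natrM natrX2 mulrA [_ / _ * _]mulrAC divfK ?pow2_neq0.
Qed.

Lemma sub_bounded Q P : (forall l v, (v < 2 ^ l)%N -> P l v -> Q l v) ->
  bounded_meas Q -> bounded_meas P.
Proof.
move=> PQ bQ n; apply: le_trans (bQ n); apply: ler_sum => l _.
rewrite ler_pM2r ?invr_gt0 ?pow2_gt0 // ler_nat /count_strings [leqLHS]big_nat_cond [leqRHS]big_nat_cond.
apply: leq_sum => v /andP[/andP[_ vl] _].
by case: asboolP => // /(PQ _ _ vl) h; case: asboolP.
Qed.

Lemma series_nd Q : nondecreasing_seq (series (wseq Q)).
Proof. by apply: nondecreasing_series => i _ _; exact: wseq_ge0. Qed.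

Lemma meas_cvg Q : bounded_meas Q -> (series (wseq Q) @ \oo --> meas Q)%classic.
Proof.
move=> bQ; apply: (nondecreasing_is_cvgn (@series_nd Q)).
by exists 1 => _ [n _ <-].
Qed.

Lemma series_le_meas Q n : bounded_meas Q -> series (wseq Q) n <= meas Q.
Proof.
move=> bQ; apply: nondecreasing_cvgn_le; first exact: series_nd.
exact: meas_cvg.
Qed.

Lemma meas_le1 Q : bounded_meas Q -> meas Q <= 1.
Proof.
move=> bQ; apply: limr_le; first exact: meas_cvg.
by apply: nearW.
Qed.

Lemma eq_meas Q P : (forall l v, (v < 2 ^ l)%N -> Q l v <-> P l v) -> meas Q = meas P.
Proof.
move=> QP; rewrite /meas; congr (limn (series _)); apply/funext => l; rewrite /wseq /count_strings.
congr (_%:R / _); apply: eq_big_nat => v /andP[_ vl]; congr nat_of_bool.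
by apply/asboolP/asboolP => /QP; apply.
Qed.

Lemma meas_split Q P : bounded_meas Q ->
  meas Q = meas (fun l v => Q l v /\ P l v) + meas (fun l v => Q l v /\ ~ P l v).
Proof.
move=> bQ; set Q1 := (X in meas X + _); set Q2 := (X in _ + meas X).
have b1 : bounded_meas Q1 by apply: sub_bounded bQ => l v _ [].
have b2 : bounded_meas Q2 by apply: sub_bounded bQ => l v _ [].
apply: (@cvg_unique _ _ (series (wseq Q) @ \oo)%classic) => //; first exact: meas_cvg.
have -> : series (wseq Q) = series (wseq Q1) \+ series (wseq Q2).
  apply/funext => n; rewrite /series /= -big_split /=; apply: eq_bigr => l _.
  rewrite /wseq -mulrDl -natrD /count_strings -big_split /=; congr (_%:R / _); apply: eq_bigr => v _.
  rewrite /Q1 /Q2; case: asboolP => h; case: asboolP => h1; case: asboolP => h2 //.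
  - by case: h1 h2 => ? ? [].
  - by case: h2; split=> // ?; apply: h1.
  - by case: h; case: h1.
  - by case: h; case: h1.
  - by case: h; case: h2.
by apply: cvgD; exact: meas_cvg.
Qed.

(** Prepending a fixed string of length r shifts the series by r terms and divides each term by
    2^r. *)
Lemma meas_shift (r rv : nat) Q : (rv < 2 ^ r)%N -> bounded_meas Q ->
  meas (fun l v => [/\ (r <= l)%N, (v %/ 2 ^ (l - r) = rv)%N & Q (l - r)%N (v %% 2 ^ (l - r))%N])
  = 2 ^- r * meas Q.
Proof.
move=> rvr bQ; set P := (X in meas X).
have E n : series (wseq P) (n + r)%N = 2 ^- r * series (wseq Q) n.
  rewrite /series /= (big_cat_nat (n := r)) ?leq_addl //= big_nat_cond big1 ?add0r; last first.
    move=> l /andP[/andP[_ lr] _]; rewrite /wseq /count_strings big1 ?mul0r // => v _.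
    by case: asboolP => // -[]; rewrite leqNgt lr.
  rewrite -{1}[r]add0n big_addn addnK big_distrr /=; apply: eq_big_nat => l _.
  suff Ec : count_strings P (l + r)%N = count_strings Q l by rewrite /wseq Ec exprD invfM [LHS]mulrA [RHS]mulrC.
  rewrite /count_strings /P addnK leq_addl addnC expnD.
  rewrite (big_cat_nat (n := rv * 2 ^ l)) ?leq_mul2r ?(ltnW rvr) ?orbT //=.
  rewrite big_nat_cond big1 ?add0n; last first.
    move=> v /andP[/andP[_ vr] _]; case: asboolP => // -[_ e _].
    by move: vr; rewrite -ltn_divLR ?expn_gt0 // e ltnn.
  rewrite (big_cat_nat (n := rv.+1 * 2 ^ l)) ?leq_mul2r ?(rvr) ?leqnSn ?orbT //=.
  rewrite [X in (_ + X)%N]big_nat_cond [X in (_ + X)%N]big1 ?addn0; last first.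
    move=> v /andP[/andP[vr _] _]; case: asboolP => // -[_ e _].
    by move: vr; rewrite -leq_divRL ?expn_gt0 // e ltnn.
  rewrite -{1}[(rv * 2 ^ l)%N]add0n big_addn -mulnBl subSnn mul1n.
  apply: eq_big_nat => v /andP[_ vl]; congr nat_of_bool.
  rewrite addnC divnMDl ?expn_gt0 // divn_small // addn0 modnMDl modn_small //.
  by apply/asboolP/asboolP => [[]|].
have bP : bounded_meas P.
  move=> n; apply: le_trans (_ : series (wseq P) (n + r)%N <= _).
    by apply: series_nd; rewrite leq_addr.
  rewrite E; apply: le_trans (bQ n); rewrite ler_piMl ?invf_le1 ?exprn_ege1 ?ler1n ?pow2_gt0 //.
  by rewrite /series /= sumr_ge0 // => i _; exact: wseq_ge0.
have H1 : ((fun n => series (wseq P) (n + r)%N) @ \oo --> meas P)%classic.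
  by have := meas_cvg bP; rewrite -(cvg_shiftn r).
have H2 : ((fun n => series (wseq P) (n + r)%N) @ \oo --> 2 ^- r * meas Q)%classic.
  by under eq_fun do rewrite E; apply: cvgMr; exact: meas_cvg.
exact: (cvg_unique _ H1 H2).
Qed.

Lemma weight_E q s : weight q s = \sum_(0 <= l < s.+1) (\sum_(0 <= v < 2 ^ l) q s l v)%N%:R / 2 ^+ l.
Proof.
rewrite /weight /weight_num natr_sum big_distrl /=; apply: eq_big_nat => l; rewrite ltnS => /andP[_ ls].
have -> : 2 ^+ s = 2 ^+ (s - l) * 2 ^+ l :> R by rewrite -exprD subnK.
by rewrite natrM natrX2 invfM mulrA mulfK ?pow2_neq0.
Qed.

Lemma weight_E_wide q s n : (s < n)%N ->
  weight q s = \sum_(0 <= l < n) (if (l <= s)%N then (\sum_(0 <= v < 2 ^ l) q s l v)%N else 0%N)%:R / 2 ^+ l.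
Proof.
move=> sn; rewrite weight_E [RHS](big_cat_nat (n := s.+1)) //= [X in _ = _ + X]big_nat_cond.
rewrite [X in _ = _ + X]big1 ?addr0; last first.
  by move=> l /andP[/andP[sl _] _]; rewrite leqNgt sl mul0r.
by apply: eq_big_nat => l; rewrite ltnS => /andP[_ ->].
Qed.

Lemma count_strings_stage q s l : nondec_stage q ->
  (\sum_(0 <= v < 2 ^ l) q s l v <= count_strings (stage_limit q) l)%N.
Proof.
move=> nd; apply: leq_sum => v _; case E: (q s l v) => //.
by case: asboolP => // -[]; exists s.
Qed.

Lemma weight_le_meas q s : nondec_stage q -> bounded_meas (stage_limit q) ->
  weight q s <= meas (stage_limit q).
Proof.
move=> nd bq; apply: le_trans (series_le_meas s.+1 bq); rewrite weight_E; apply: ler_sum => l _.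
by rewrite ler_pM2r ?invr_gt0 ?pow2_gt0 // ler_nat count_strings_stage.
Qed.

Lemma weight_nd q : nondec_stage q -> forall s s', (s <= s')%N -> weight q s <= weight q s'.
Proof.
move=> nd s s' ss'; rewrite (@weight_E_wide q s s'.+1) // weight_E; apply: ler_sum_nat => l _.
rewrite ler_pM2r ?invr_gt0 ?pow2_gt0 // ler_nat; case: ifP => // _.
by apply: leq_sum => v _; case E: (q s l v) => //; rewrite (nd s s').
Qed.

(** There are finitely many strings of length below n, so one stage settles those that ever
    enter. *)
Lemma stage_uniform q n : nondec_stage q -> exists s, (n <= s)%N /\ forall l v, (l < n)%N ->
  (v < 2 ^ l)%N -> stage_limit q l v -> q s l v.
Proof.
move=> nd.
have H l m : exists s, forall v, (v < m)%N -> stage_limit q l v -> q s l v.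
  elim: m => [|m [s Hs]]; first by exists 0%N.
  have [[t Ht]|h] := pselect (stage_limit q l m); last first.
    exists s => v; rewrite ltnS leq_eqVlt => /orP[/eqP->//|]; exact: Hs.
  exists (maxn s t) => v; rewrite ltnS leq_eqVlt => /orP[/eqP-> _|vm /(Hs v vm)].
    by apply: nd Ht; exact: leq_maxr.
  by apply: nd; exact: leq_maxl.
elim: n => [|n [s [ns Hs]]]; first by exists 0%N.
have [t Ht] := H n (2 ^ n)%N.
exists (maxn s (maxn t n.+1)); split; first by rewrite !leq_max leqnn !orbT.
move=> l v; rewrite ltnS leq_eqVlt => /orP[/eqP-> vn h|ln vl h].
  by apply: nd (Ht _ vn h); rewrite !leq_max leqnn !orbT.
by apply: nd (Hs _ _ ln vl h); exact: leq_maxl.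
Qed.

Lemma weight_cvg q : nondec_stage q -> bounded_meas (stage_limit q) ->
  (weight q @ \oo --> meas (stage_limit q))%classic.
Proof.
move=> nd bq.
have ndW : nondecreasing_seq (weight q) by move=> s s' ss'; exact: weight_nd.
have cvgW : cvgn (weight q).
  apply: nondecreasing_is_cvgn ndW _; exists (meas (stage_limit q)) => _ [s _ <-].
  exact: weight_le_meas.
suff -> : meas (stage_limit q) = limn (weight q) by [].
apply/eqP; rewrite eq_le; apply/andP; split; last first.
  by apply: limr_le => //; apply: nearW => s; exact: weight_le_meas.
apply: limr_le; first exact: meas_cvg.
apply: nearW => n; have [s [ns Hs]] := stage_uniform n nd.
apply: le_trans (nondecreasing_cvgn_le ndW cvgW s).
rewrite weight_E (big_cat_nat (n := n)) ?(leq_trans ns) //=.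
rewrite -[leLHS]addr0 lerD ?sumr_ge0 //; last by move=> i _; rewrite divr_ge0 // ltW ?pow2_gt0.
apply: ler_sum_nat => l /andP[_ ln]; rewrite ler_pM2r ?invr_gt0 ?pow2_gt0 // ler_nat.
rewrite /count_strings [X in (X <= _)%N]big_nat_cond [X in (_ <= X)%N]big_nat_cond; apply: leq_sum => v /andP[/andP[_ vl] _].
by case: asboolP => // /(Hs l v ln vl) ->.
Qed.

(** The strings in [req] enter eventually but are not counted in [weight q s], being too long or not
    yet present, so their weight comes on top of it. *)
Lemma weight_gap q s M (req : nat -> nat -> bool) : nondec_stage q -> bounded_meas (stage_limit q) ->
  (forall l v, (v < 2 ^ l)%N -> req l v -> stage_limit q l v /\ ~ ((l <= s)%N /\ q s l v)) ->
  weight q s + \sum_(0 <= l < M) (\sum_(0 <= v < 2 ^ l) req l v)%N%:R / 2 ^+ l <= meas (stage_limit q).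
Proof.
move=> nd bq Hreq; apply: le_trans (series_le_meas (s + M).+1 bq).
rewrite (@weight_E_wide q s (s + M).+1); last by lia.
have HM : \sum_(0 <= l < M) (\sum_(0 <= v < 2 ^ l) req l v)%N%:R / 2 ^+ l <=
    \sum_(0 <= l < (s + M).+1) (\sum_(0 <= v < 2 ^ l) req l v)%N%:R / 2 ^+ l :> R.
  rewrite [leRHS](big_cat_nat (n := M)) //=; last lia.
  by rewrite lerDl sumr_ge0 // => i _; rewrite divr_ge0 // ltW ?pow2_gt0.
apply: le_trans (lerD (lexx _) HM) _.
rewrite -big_split /=; apply: ler_sum => l _; rewrite -mulrDl ler_pM2r ?invr_gt0 ?pow2_gt0 //.
rewrite -natrD ler_nat; case: (leqP l s) => ls; last first.
  rewrite add0n /count_strings [X in (X <= _)%N]big_nat_cond [X in (_ <= X)%N]big_nat_cond; apply: leq_sum => v /andP[/andP[_ vl] _].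
  by case E: (req l v) => //; have [h _] := Hreq _ _ vl E; case: asboolP.
rewrite -big_split /= /count_strings [X in (X <= _)%N]big_nat_cond [X in (_ <= X)%N]big_nat_cond; apply: leq_sum => v /andP[/andP[_ vl] _].
case E: (req l v) => /=.
  have [h1 h2] := Hreq _ _ vl E; case E2: (q s l v); first by case: h2.
  by case: asboolP.
by rewrite addn0; case E2: (q s l v) => //; case: asboolP => // -[]; exists s.
Qed.

End Weights.

(** * Forcing *)

Lemma const_code n : exists c, forall v, eval c v n.
Proof.
elim: n => [|n [c Hc]]; first by exists CZero => v; exact: ev_zero.
exists (CComp CSucc [:: c]) => v.
by apply: (@ev_comp _ _ _ [:: n]); [apply: evs_cons (Hc v) _; exact: evs_nil|exact: (@ev_succ [:: n])].
Qed.

(** [ev_comp] demands that the inner code converge, so composing a constant with [c] keeps the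
    domain and replaces the outputs. *)
Lemma const_comp_code c y : exists c', forall v z, eval c' v z <-> z = y /\ exists w, eval c v w.
Proof.
have [k Hk] := const_code y; exists (CComp k [:: c]) => v z; split.
  move=> H; inversion H as [| | |f' gs' v' ws y' Hws Hy| | |]; subst.
  inversion Hws as [|g' gs' v' w ws' Hw _]; subst.
  by split; [exact: eval_inj Hy (Hk _)|exists w].
move=> [-> [w Hw]]; apply: (@ev_comp _ _ _ [:: w]) (Hk _).
by apply: evs_cons Hw _; exact: evs_nil.
Qed.

Lemma decidable_machine (accepts : nat -> bool) (y : seq bool) : cf1 (fun m => nat_of_bool (accepts m)) ->
  (forall s t, accepts (enc s) -> accepts (enc t) -> prefix s t -> s = t) ->
  prefix_free_machine (fun s => if accepts (enc s) then Some y else None).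
Proof.
move=> HD pf; split; last first.
  by move=> s t; case: ifP => // Ds _; case: ifP => // accepts_at _; exact: pf.
(* The tested value ignores the search variable: minimization stops at 0 if the input is accepted
   and diverges otherwise. *)
have [c Hc] : cf 2 (fun v => nat_of_bool (~~ accepts (nth 0 v 1))).
  by apply: cf_neg; apply: (cf_app1 HD); exact: cf_nth.
have [c' Hc'] := const_comp_code (CMu c) (enc y).
exists c' => s t; rewrite Hc'; split.
  case: ifP => // Ds [<-]; split=> //; exists 0; apply: ev_mu => //.
  by have := Hc [:: 0; enc s] erefl; rewrite /= Ds.
move=> [/enc_inj -> [w Hw]]; inversion Hw as [| | | | | |f' v' n H0 _]; subst.
have := Hc [:: w; enc s] erefl => /= H1.
by have := eval_inj H0 H1; case: (accepts (enc s)).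
Qed.

Lemma constant_machine (U : pfun) (x : seq bool) : prefix_free_machine U ->
  prefix_free_machine (fun s => if U s is Some _ then Some x else None).
Proof.
move=> [[c Hc] pf]; split; last first.
  by move=> s t Hs Ht; apply: pf; [case: (U s) Hs|case: (U t) Ht].
have [c' Hc'] := const_comp_code c (enc x); exists c' => s t; rewrite Hc'; split.
  case E: (U s) => [u|] // [<-]; split=> //; exists (enc u); exact/Hc.
move=> [/enc_inj -> [w Hw]]; have [u Eu] := enc_surj w.
by move: Hw; rewrite -Eu => /Hc ->.
Qed.

(** A self-delimiting code of e, so that one prefix-free machine can hold a separate part for each
    candidate index. *)
Definition tag_prefix e : seq bool := rcons (nseq e true) false.

Lemma size_pre e : size (tag_prefix e) = e.+1.
Proof. by rewrite size_rcons size_nseq. Qed.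

Lemma val_pre e : bval (tag_prefix e) = 2 ^ e.+1 - 2.
Proof.
rewrite /tag_prefix bval_rcons addn0.
suff -> : bval (nseq e true) = 2 ^ e - 1 by rewrite expnS; lia.
elim: e => // e IH; rewrite -[nseq _ _]/(true :: nseq e true) -cat1s bval_cat IH size_nseq.
by rewrite expnS /bval /=; have := expn_gt0 2 e; lia.
Qed.

Lemma prefix_pre e e' u u' : prefix (tag_prefix e ++ u) (tag_prefix e' ++ u') -> e = e' /\ prefix u u'.
Proof. by elim: e e' => [|e IH] [|e'] //= /IH [->]. Qed.

Section Forcing.
Variables (L : nat -> pfun) (U : pfun).
Hypothesis HL : effective_list_pfm L.
Variable sig : nat -> seq bool.
Hypothesis Hsig : total_computable_str sig.
Hypothesis Usig : forall e t, U (sig e ++ t) = L e t.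
Variable cU : code.
Hypothesis HcU : forall s t, U s = Some t <-> eval cU [:: enc s] (enc t).

(** For v < 2^l the input is [enc (str l v)]. *)
Definition halts s l v := 0 < run cU s [:: (2 ^ l + v).-1].

Lemma halts_nd s s' l v : s <= s' -> halts s l v -> halts s' l v.
Proof.
move=> ss'; rewrite /halts; case E: (run cU s _) => [//|k] _.
by rewrite (runS ss' E).
Qed.

Lemma haltsP l v : v < 2 ^ l -> (exists s, halts s l v) <-> exists t, U (str l v) = Some t.
Proof.
move=> vl; rewrite /halts -enc_str //; split.
  move=> [s]; case E: (run cU s _) => [//|k] _; have [t Et] := enc_surj k.
  by exists t; apply/HcU; rewrite Et; apply/evalP; exists s.
by move=> [t /HcU /evalP[s Hs]]; exists s; rewrite Hs.
Qed.

(** Only the code of [sig e] is given; its length is the binary logarithm of that code plus one,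
    found by counting powers of 2. *)
Lemma cf_size_sig : cf1 (fun e => size (sig e)).
Proof.
case: Hsig => c Hc; have Hs : cf1 (fun e => enc (sig e)) by exists c => -[//|e []].
apply: (@cf_ext _ (fun v => \sum_(0 <= i < enc (sig (nth 0 v 0))) (2 ^ i.+1 <= (enc (sig (nth 0 v 0))).+1))).
  move=> v _; move: (sig _) => s; rewrite encE prednK ?addn_gt0 ?expn_gt0 //.
  have vs := bval_lt s; have ls := ltn_expl (size s) (isT : 1 < 2).
  have ls' : size s <= (2 ^ size s + bval s).-1 by lia.
  rewrite (big_cat_nat (n := size s)) //= (eq_big_nat _ _ (F2 := fun=> 1)).
    rewrite sum_nat_const_nat subn0 muln1 big_nat_cond big1 ?addn0 // => i /andP[/andP[h _] _].
    suff : 2 ^ (size s).+1 <= 2 ^ i.+1 by rewrite expnS; lia.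
    by rewrite leq_exp2l.
  move=> i /andP[_ h]; suff -> : 2 ^ i.+1 <= 2 ^ size s + bval s by [].
  by apply: leq_trans (leq_addr _ _); rewrite leq_exp2l.
have H : cf 1 (fun v => enc (sig (nth 0 v 0))) by exact: Hs.
apply: (@cf_sum _ _ (fun i v => nat_of_bool (2 ^ i.+1 <= (enc (sig (nth 0 v 0))).+1))) => //.
apply: cf_leq; first cfauto.
by apply: cf_succ; apply: (cf_app1 Hs); cfauto.
Qed.

(** The length of [sig e ++ tag_prefix e]: inside [U] a request served for e is scaled by 2 to the
    power minus this. *)
Definition Kof e := size (sig e) + e.+1.

Lemma cf_Kof : cf1 Kof.
Proof. by apply: cf_add; [exact: cf_size_sig|cfauto]. Qed.

Variables (r : nat -> nat -> nat) (g : nat -> nat).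
Hypotheses (Hr : cf2 r) (Hg : cf1 g) (gS : forall t, g t < g t.+1).

Lemma g_mono t t' : t <= t' -> g t <= g t'.
Proof. by move=> tt'; rewrite -(subnK tt'); elim: (t' - t) => // n IH; rewrite addSn; apply: leq_trans IH (ltnW (gS _)). Qed.
Lemma g_lt t t' : t < t' -> g t < g t'.
Proof. by move=> tt'; apply: leq_trans (gS t) (g_mono tt'). Qed.
Lemma g_ge t : t <= g t.
Proof. by elim: t => // t IH; apply: leq_ltn_trans IH (gS t). Qed.
Lemma g_inj t t' : g t = g t' -> t = t'.
Proof. by move=> E; case: (ltngtP t t') => // /g_lt; rewrite E ltnn. Qed.

(* In units of [2 ^ - g t], the part of the unit interval allocated before stage [t]; the
   lengths [g t] being increasing, requests are served from left to right. *)
Definition alloc e t := iteri t (fun i z => (z + r e i) * 2 ^ (g i.+1 - g i)) 0.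

(** Measured in the finer unit, the end of the block served at t stays at or left of the start of
    each later block. *)
Lemma alloc_step e t t' : t < t' -> (alloc e t + r e t) * 2 ^ (g t' - g t) <= alloc e t'.
Proof.
elim: t' => // t' IH; rewrite ltnS leq_eqVlt => /orP[/eqP->//|tt'].
have -> : g t'.+1 - g t = (g t' - g t) + (g t'.+1 - g t').
  by have := g_lt tt'; have := gS t'; lia.
rewrite expnD mulnA; apply: leq_trans (_ : alloc e t' * 2 ^ (g t'.+1 - g t') <= _).
  by rewrite leq_mul2r IH ?orbT.
by rewrite [alloc e t'.+1]/(alloc e t'.+1) /alloc /= -/(alloc e t') leq_mul2r leq_addr orbT.
Qed.

(* The code of [sig e ++ tag_prefix e ++ str l v]. *)
Definition req_code e l v :=
  (((enc (sig e)).+1 * 2 ^ e.+1 + (2 ^ e.+1 - 2)) * 2 ^ l + v).-1.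

Lemma req_codeE e l v : v < 2 ^ l -> req_code e l v = enc (sig e ++ tag_prefix e ++ str l v).
Proof.
move=> vl; rewrite /req_code [RHS]encE !size_cat !bval_cat !size_cat size_str val_str //.
rewrite size_pre val_pre encE prednK ?addn_gt0 ?expn_gt0 //; congr predn.
by rewrite !expnD !mulnDl; lia.
Qed.

(* The machine tests its own index [e] for consistency, which makes a fixed point
   theorem unnecessary: on inputs [tag_prefix e ++ _] it assumes that its index is [e]. *)
Definition accepts_at m e t v :=
  [&& m.+1 == (2 ^ e.+2 - 2) * 2 ^ (g t) + v, v < 2 ^ (g t), alloc e t <= v, v < alloc e t + r e t
    & run cU t [:: req_code e (g t) v] == 0].
Definition accepts m := has (fun e => has (fun t => has (fun v => accepts_at m e t v) (iota 0 m.+2))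
  (iota 0 m.+2)) (iota 0 m.+2).

Lemma cf_accepts : cf1 (fun m => nat_of_bool (accepts m)).
Proof.
case: Hsig => c Hc; have Hs : cf1 (fun e => enc (sig e)) by exists c => -[//|e []].
have HF : cf2 alloc.
  apply: (@cf_iteri _ _ _ (fun i z v => (z + r (nth 0 v 0) i) * 2 ^ (g i.+1 - g i))); [cfauto|cfauto|].
  apply: cf_mul.
    by apply: cf_add; [cfauto|apply: (cf_app2 Hr); cfauto].
  apply: cf_exp; first cfauto.
  by apply: cf_sub; apply: (cf_app1 Hg); cfauto.
have HC : cf3 req_code.
  rewrite /req_code; apply: cf_pred; apply: cf_add; last cfauto.
  apply: cf_mul; last cfauto; apply: cf_add; last cfauto.
  by apply: cf_mul; [apply: cf_succ; apply: (cf_app1 Hs); cfauto|cfauto].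
have Hat : cf4 (fun m e t v => nat_of_bool (accepts_at m e t v)).
  have G k f : cf k f -> cf k (fun v => g (f v)) by exact: cf_app1.
  have alloc' k f h : cf k f -> cf k h -> cf k (fun v => alloc (f v) (h v)) by exact: cf_app2.
  have R' k f h : cf k f -> cf k h -> cf k (fun v => r (f v) (h v)) by exact: cf_app2.
  rewrite /accepts_at; apply: cf_and.
    by apply: cf_eq; [cfauto|apply: cf_add; [apply: cf_mul; [cfauto|apply: cf_exp; [cfauto|apply: G; cfauto]]|cfauto]].
  apply: cf_and; first by apply: cf_leq; [cfauto|apply: cf_exp; [cfauto|apply: G; cfauto]].
  apply: cf_and; first by apply: cf_leq; [apply: alloc'; cfauto|cfauto].
  apply: cf_and.
    by apply: cf_leq; [cfauto|apply: cf_add; [apply: alloc'; cfauto|apply: R'; cfauto]].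
  apply: cf_eq; last cfauto.
  apply: (cf_app2 (cf_run1 cU)); first cfauto.
  by apply: (cf_app3 HC); [cfauto|apply: G; cfauto|cfauto].
rewrite /accepts.
apply: (@cf_has _ _ (fun e u => has (fun t => has (fun v => accepts_at (nth 0 u 0) e t v)
  (iota 0 (nth 0 u 0).+2)) (iota 0 (nth 0 u 0).+2))); first cfauto.
apply: (@cf_has _ _ (fun t u => has (fun v => accepts_at (nth 0 (behead u) 0) (nth 0 u 0) t v)
  (iota 0 (nth 0 (behead u) 0).+2))); first cfauto.
apply: (@cf_has _ _ (fun v u => accepts_at (nth 0 (behead (behead u)) 0) (nth 0 (behead u) 0) (nth 0 u 0) v)); first cfauto.
by apply: (cf_app4 Hat); cfauto.
Qed.

Lemma enc_pre e l v : v < 2 ^ l -> (enc (tag_prefix e ++ str l v)).+1 = (2 ^ e.+2 - 2) * 2 ^ l + v.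
Proof.
move=> vl; rewrite encE prednK ?addn_gt0 ?expn_gt0 // size_cat bval_cat size_str val_str //.
rewrite size_pre val_pre expnD addnA -mulnDl; congr (_ * _ + _).
by rewrite [2 ^ e.+2]expnS; have := expn_gt0 2 e; rewrite expnS; lia.
Qed.

Lemma acceptsP s : accepts (enc s) <-> exists e t v, [/\ s = tag_prefix e ++ str (g t) v, v < 2 ^ (g t),
  alloc e t <= v, v < alloc e t + r e t & run cU t [:: req_code e (g t) v] = 0].
Proof.
split.
  move=> /hasP[e _ /hasP[t _ /hasP[v _ /and5P[/eqP E h1 h2 h3 /eqP h4]]]].
  exists e, t, v; split=> //; apply: enc_inj; apply/eqP; rewrite -eqSS E.
  by rewrite enc_pre.
move=> [e [t [v [-> h1 h2 h3 h4]]]].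
have E := enc_pre e h1.
(* The code of an accepted string bounds e, t and v, so the bounded searches in [accepts] find
   them. *)
have p1 := ltn_expl e (isT : 1 < 2); have p2 := ltn_expl (g t) (isT : 1 < 2).
have p3 : 2 ^ g t <= (2 ^ e.+2 - 2) * 2 ^ g t by rewrite leq_pmull // !expnS; have := expn_gt0 2 e; lia.
have p4 : 2 ^ e.+2 - 2 <= (2 ^ e.+2 - 2) * 2 ^ g t by rewrite leq_pmulr // expn_gt0.
have p5 := g_ge t.
have p6 : e <= 2 ^ e.+2 - 2 by rewrite !expnS; lia.
apply/hasP; exists e; first by rewrite mem_iota; lia.
apply/hasP; exists t; first by rewrite mem_iota; lia.
apply/hasP; exists v; first by rewrite mem_iota; lia.
by rewrite /accepts_at E eqxx h1 h2 h3 h4.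
Qed.

(** Distinct tags are incomparable. Under the same tag, [alloc_step] puts all extensions of the
    strings of a block to the left of every later block, and within one block all lengths agree. *)
Lemma accepts_prefix_free s t : accepts (enc s) -> accepts (enc t) -> prefix s t -> s = t.
Proof.
move=> /acceptsP[e [i [v [-> h1 h2 h3 _]]]] /acceptsP[e' [j [w [-> k1 k2 k3 _]]]].
move=> /prefix_pre[Ee]; subst e'; rewrite prefix_str !size_str !val_str // in k2 k3 *.
move=> /andP[gij /eqP E].
have ij : i <= j by rewrite leqNgt; apply/negP => /g_lt; lia.
move: ij E; rewrite leq_eqVlt => /orP[/eqP <-|ij].
  by rewrite subnn divn1 => ->.
move=> E; have := alloc_step e ij.
have : v.+1 * 2 ^ (g j - g i) <= (alloc e i + r e i) * 2 ^ (g j - g i) by rewrite leq_mul2r h3 orbT.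
have : w < v.+1 * 2 ^ (g j - g i) by rewrite -ltn_divLR ?expn_gt0 // E.
lia.
Qed.

Variables (R : realType) (y : seq bool).
Hypothesis Hreq : forall e T,
  (\sum_(0 <= t < T) (r e t)%:R / 2 ^+ (g t) <= 1 :> R)%R.

Lemma alloc_sum e t : ((alloc e t)%:R / 2 ^+ (g t) = \sum_(0 <= i < t) (r e i)%:R / 2 ^+ (g i) :> R)%R.
Proof.
elim: t => [|t IH]; first by rewrite big_geq // mul0r.
rewrite big_nat_recr //= -IH /alloc /= -/(alloc e t) -mulrDl -natrD natrM natrX2.
have -> : (2 ^+ g t.+1 = 2 ^+ (g t.+1 - g t) * 2 ^+ g t :> R)%R.
  by rewrite -exprD subnK // ltnW.
by rewrite invfM mulrA mulfK ?pow2_neq0.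
Qed.

Lemma alloc_bound e t : alloc e t + r e t <= 2 ^ (g t).
Proof.
rewrite -(ler_nat R) natrD natrX2 -(ler_pM2r (x := (2 ^+ g t)^-1)%R) ?invr_gt0 ?pow2_gt0 //.
rewrite mulfV ?pow2_neq0 // mulrDl alloc_sum; have := Hreq e t.+1.
by rewrite big_nat_recr.
Qed.

(** Let e be a true index of the machine. If [U] halted on an allocated string within t steps, the
    machine would accept that string, but acceptance requires that it has not been seen to halt by
    stage t. Hence the test succeeds, the string is accepted, and it halts only after stage t. *)
Lemma forcing : exists e, forall t v, alloc e t <= v < alloc e t + r e t ->
  U (sig e ++ tag_prefix e ++ str (g t) v) = Some y /\
  ~ halts t (Kof e + g t) (bval (sig e ++ tag_prefix e) * 2 ^ (g t) + v).
Proof.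
have [_ _ HLM] := HL.
have [e He] := HLM _ (@decidable_machine accepts y cf_accepts accepts_prefix_free).
exists e => t v /andP[h1 h2].
have vl : v < 2 ^ g t by apply: leq_trans h2 (alloc_bound e t).
have E1 : (2 ^ (Kof e + g t) + (bval (sig e ++ tag_prefix e) * 2 ^ g t + v)).-1 = req_code e (g t) v.
  by rewrite req_codeE // catA str_cat // size_cat size_pre enc_str // /Kof expnD;
    have := bval_lt (sig e ++ tag_prefix e); rewrite size_cat size_pre => h;
    apply: leq_trans (_ : (bval (sig e ++ tag_prefix e)).+1 * 2 ^ g t <= _);
    [rewrite mulSn; lia|rewrite leq_mul2r h orbT].
have H0 : run cU t [:: req_code e (g t) v] = 0.
  case E: (run cU t _) => [//|k]; have [u Eu] := enc_surj k.
  have : U (sig e ++ tag_prefix e ++ str (g t) v) = Some u.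
    by apply/HcU; rewrite Eu -req_codeE //; apply/evalP; exists t.
  rewrite Usig He; case: ifP => // /acceptsP[e' [t' [v' [Es v'l _ _ R0]]]] _.
  have [Ee Ep] : e = e' /\ prefix (str (g t) v) (str (g t') v').
    by apply: prefix_pre; rewrite Es prefix_refl.
  move: Es; rewrite -Ee => /eqP; rewrite eqseq_cat // eqxx /= => /eqP Es.
  have Eg : g t = g t' by have := f_equal size Es; rewrite !size_str.
  have Et := g_inj Eg; move: R0 Es v'l; rewrite -Ee -Et => R0 Es v'l.
  by have := f_equal bval Es; rewrite !val_str // => Ev; move: R0; rewrite -Ev E.
split; last by rewrite /halts E1 H0.
rewrite Usig He; suff -> : accepts (enc (tag_prefix e ++ str (g t) v)) by [].
by apply/acceptsP; exists e, t, v.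
Qed.

End Forcing.

(** * Reduction to a statement about weights of strings *)

Local Open Scope ring_scope.

(** All that the analysis needs to know about [U] and X: [qa] and [qb] are the stages of A and B,
    and the factor in [hs_z] is 1 + d. In [hs_force] the requests are fixed for all e before the
    index is found, so they may be computed from [K e]; those made from stage s on count as growth
    after s. *)
Record halting_system (R : realType) (z : R) (r : nat) (qa qb : nat -> nat -> nat -> bool)
    (K : nat -> nat) : Prop := HaltingSystem {
  hs_r : (0 < r)%N;
  hs_cfa : cf3 (fun s l v => nat_of_bool (qa s l v));
  hs_cfb : cf3 (fun s l v => nat_of_bool (qb s l v));
  hs_nda : nondec_stage qa;
  hs_ndb : nondec_stage qb;
  hs_bda : bounded_meas R (stage_limit qa);
  hs_sub : forall s l v, (v < 2 ^ l)%N -> qb s l v -> qa s l v;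
  hs_z : z = 2 ^+ r / (2 ^+ r - 1) * meas R (stage_limit qa) - meas R (stage_limit qb);
  hs_cfK : cf1 K;
  hs_force : forall rq g, cf2 rq -> cf1 g -> (forall t, (g t < g t.+1)%N) ->
    (forall e T, \sum_(0 <= t < T) (rq e t)%:R / 2 ^+ (g t) <= 1 :> R) ->
    exists e, forall s T, weight R qa s +
      (\sum_(s <= t < T) (rq e t)%:R / 2 ^+ (g t)) / 2 ^+ (K e) <= meas R (stage_limit qa) }.

(** A string served at stage t >= s is absent at t, hence also at s. Blocks of different stages have
    different lengths, so their weights add up. *)
Lemma forced_growth (R : realType) (q : nat -> nat -> nat -> bool) (rq alloc g : nat -> nat) (k b s T : nat) :
  (forall t, (g t < g t.+1)%N) -> nondec_stage q -> bounded_meas R (stage_limit q) ->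
  (b < 2 ^ k)%N -> (forall t, (alloc t + rq t <= 2 ^ g t)%N) ->
  (forall t v, (alloc t <= v < alloc t + rq t)%N -> stage_limit q (k + g t)%N (b * 2 ^ g t + v)%N) ->
  (forall t v, (alloc t <= v < alloc t + rq t)%N -> ~ q t (k + g t)%N (b * 2 ^ g t + v)%N) ->
  weight R q s + (\sum_(s <= t < T) (rq t)%:R / 2 ^+ (g t)) / 2 ^+ k <= meas R (stage_limit q).
Proof.
move=> gS nd bd bk Fb Hlim Hnew.
have glt t t' : (t < t')%N -> (g t < g t')%N.
  elim: t' => // t' IH; rewrite ltnS leq_eqVlt => /orP[/eqP->//|/IH h].
  exact: ltn_trans h (gS _).
pose req l v := `[< exists t, [/\ (s <= t)%N, l = (k + g t)%N,
  (b * 2 ^ g t + alloc t <= v)%N & (v < b * 2 ^ g t + (alloc t + rq t))%N] >].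
have [Ts|sT] := leqP T s.
  by rewrite big_geq // mul0r addr0 weight_le_meas.
apply: le_trans (@weight_gap R q s (k + g T)%N req nd bd _); last first.
  move=> l v vl /asboolP[t [st -> h1 h2]].
  have vE : v = (b * 2 ^ g t + (v - b * 2 ^ g t))%N by lia.
  have h : (alloc t <= v - b * 2 ^ g t < alloc t + rq t)%N by lia.
  split; first by rewrite vE; exact: Hlim.
  case=> _ /(nd _ _ _ _ st); rewrite vE; exact: Hnew.
rewrite lerD2l; elim: T sT => // T IH; rewrite ltnS => sT.
pose f l : R := (\sum_(0 <= v < 2 ^ l) req l v)%N%:R / 2 ^+ l.
have f0 l : 0 <= f l by rewrite divr_ge0 // ltW ?pow2_gt0.
rewrite big_nat_recr //= mulrDl [leRHS](big_cat_nat (n := (k + g T)%N)) //=; last first.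
  by have := gS T; lia.
apply: lerD.
  move: sT; rewrite leq_eqVlt => /orP[/eqP<-|/IH//].
  by rewrite big_geq // mul0r sumr_ge0 // => l _; exact: f0.
rewrite big_ltn ?ltn_add2l // -[leLHS]addr0 lerD ?sumr_ge0 // => [|l _]; last exact: f0.
rewrite /f exprD invfM mulrA mulrAC ler_pM2r ?invr_gt0 ?pow2_gt0 // mulrC mulrC.
rewrite ler_pM2r ?invr_gt0 ?pow2_gt0 // ler_nat.
have bd2 : (b * 2 ^ g T + (alloc T + rq T) <= 2 ^ (k + g T))%N.
  apply: leq_trans (_ : b.+1 * 2 ^ g T <= _)%N.
    by rewrite mulSn addnC leq_add2r.
  by rewrite expnD leq_mul2r bk orbT.
rewrite (big_cat_nat (n := b * 2 ^ g T + alloc T)) //=; last lia.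
rewrite (big_cat_nat (n := b * 2 ^ g T + (alloc T + rq T)) (m := b * 2 ^ g T + alloc T)) //=; last lia.
rewrite [X in (_ <= _ + (X + _))%N](eq_big_nat _ _ (F2 := fun=> 1%N)).
  by rewrite sum_nat_const_nat; lia.
move=> v /andP[h1 h2]; have -> // : req (k + g T)%N v.
by apply/asboolP; exists T.
Qed.

Lemma reduction (R : realType) (L : nat -> pfun) (U : pfun) (X : seq bool -> Prop) :
  effective_list_pfm L -> universal_pfm L U -> Pi01_set X -> (exists s, X s) ->
  exists r qa qb K, halting_system (halting_prob R U X) r qa qb K.
Proof.
move=> HL [HU [sig [Hsig Usig]]] [cX HcX] [x Xx].
have [[cU HcU] pfU] := HU; have [_ _ HLM] := HL.
have [e0 He0] := HLM _ (constant_machine x HU).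
pose rho := sig e0; pose r := size rho.
have Urho t : U (rho ++ t) = if U t is Some _ then Some x else None.
  by rewrite Usig He0.
have rhol : (bval rho < 2 ^ r)%N by exact: bval_lt.
pose ext l v := (r <= l)%N && (v %/ 2 ^ (l - r) == bval rho)%N.
pose H l v := exists t, U (str l v) = Some t.
pose qa s l v := halts cU s l v && ~~ ext l v.
pose out s l v := (run cU s [:: (2 ^ l + v).-1]).-1.
pose qb s l v := halts cU s l v && (0 < run cX s [:: out s l v])%N.
have hP l v : (v < 2 ^ l)%N -> (exists s, halts cU s l v) <-> H l v by exact: haltsP.
have outP s l v t : (v < 2 ^ l)%N -> halts cU s l v -> U (str l v) = Some t -> out s l v = enc t.
  move=> vl; rewrite /halts /out; case E: (run cU s _) => [//|k] _ /HcU.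
  rewrite enc_str //; apply: eval_inj; apply/evalP; exists s; exact: E.
have XP t : (exists s, (0 < run cX s [:: enc t])%N) <-> ~ X t.
  rewrite HcX; split.
    by move=> [s]; case E: (run cX s _) => [//|k] _; exists k; apply/evalP; exists s.
  by move=> [y /evalP[s Hs]]; exists s; rewrite Hs.
have extE l v : (v < 2 ^ l)%N -> ext l v -> str l v = rho ++ str (l - r) (v %% 2 ^ (l - r)).
  move=> vl /andP[rl /eqP E]; rewrite str_cat ?ltn_pmod ?expn_gt0 // -E -divn_eq.
  by rewrite -/r subnKC.
have nda : nondec_stage qa.
  by move=> s s' l v ss' /andP[h1 h2]; rewrite /qa h2 (halts_nd ss' h1).
have ndb : nondec_stage qb.
  move=> s s' l v ss' /andP[h1 h2]; apply/andP; split; first exact: halts_nd h1.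
  have -> : out s' l v = out s l v.
    by move: h1; rewrite /halts /out; case E: (run cU s _) => [//|k] _; rewrite (runS ss' E).
  by move: h2; case E: (run cX s _) => [//|k] _; rewrite (runS ss' E).
have pfH : prefix_free_set H.
  move=> l v m w lm wm [t Ht] [u Hu] E.
  have vl : (v < 2 ^ l)%N by rewrite -E ltn_divLR ?expn_gt0 // -expnD subnKC.
  have := pfU (str l v) (str m w); rewrite Ht Hu => /(_ _ _ _).
  have -> : prefix (str l v) (str m w) by rewrite prefix_str !size_str lm !val_str // E eqxx.
  by move=> /(_ ltac:(by []) ltac:(by []) isT) /(f_equal size); rewrite !size_str.
have bH := @pf_bounded R H pfH.
pose HX l v := exists t, U (str l v) = Some t /\ X t.
have EA : meas R (stage_limit qa) = meas R (fun l v => H l v /\ ~ ext l v).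
  apply: eq_meas => l v vl; rewrite /stage_limit /qa; split.
    by move=> [s /andP[h1 /negP h2]]; split=> //; apply/hP => //; exists s.
  by move=> [/hP -/(_ vl)[s hs] /negP h2]; exists s; rewrite hs.
have EB : meas R (stage_limit qb) = meas R (fun l v => H l v /\ ~ HX l v).
  apply: eq_meas => l v vl; rewrite /stage_limit; split.
    move=> [s /andP[h1 h2]]; have [t Ht] : H l v by apply/hP => //; exists s.
    split; first by exists t.
    move=> [u [Hu Xu]]; move: Hu; rewrite Ht => -[E]; subst u.
    suff : ~ X t by []; apply/XP; exists s; by rewrite -(outP _ _ _ _ vl h1 Ht).
  move=> [h nX]; have [s hs] := (hP _ _ vl).2 h; have [t Ht] := h.
  have /XP[s' hs'] : ~ X t by move=> Xt; apply: nX; exists t.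
  have hm := halts_nd (leq_maxl s s') hs.
  exists (maxn s s'); rewrite /qb hm (outP _ _ _ _ vl hm Ht) /=.
  by move: hs'; case E: (run cX s' _) => [//|k] _; rewrite (runS (leq_maxr s s') E).
have EX : halting_prob R U X = meas R (fun l v => H l v /\ HX l v).
  rewrite halting_probE; apply: eq_meas => l v _; split=> [[t [h1 h2]]|[_]//].
  by split; exists t.
(* [U] halts on [rho ++ s] exactly when it halts on s, so this set is the shift of [H] by [rho]. *)
have Eext : meas R (fun l v => H l v /\ ext l v) = 2 ^- r * meas R H.
  rewrite -(meas_shift rhol bH); apply: eq_meas => l v vl; split.
    move=> [[t Ht] e]; have := extE _ _ vl e => E; case/andP: e => rl /eqP e.
    split=> //; move: Ht; rewrite E Urho; case E2: (U _) => [u|//] _; by exists u.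
  move=> [rl e [t Ht]]; have ev : ext l v by rewrite /ext rl e eqxx.
  by split=> //; exists x; rewrite (extE _ _ vl ev) Urho Ht.
have S1 := meas_split HX bH; have S2 := meas_split (fun l v => ext l v) bH.
have bA : bounded_meas R (stage_limit qa).
  suff : prefix_free_set (stage_limit qa) by exact: pf_bounded.
  move=> l v m w lm wm [s /andP[hs _]] [s' /andP[hs' _]] E.
  have vl : (v < 2 ^ l)%N by rewrite -E ltn_divLR ?expn_gt0 // -expnD subnKC.
  by apply: (pfH _ _ _ _ lm wm _ _ E); apply/hP => //; [exists s|exists s'].
(* Any output other than x will do: strings extending [rho] output x, so strings that output y do
   not extend it and count in A. *)
pose y := x ++ [:: true].
have yx : y <> x by move/(f_equal size); rewrite size_cat /=; lia.
have force := @forcing L U HL sig Hsig Usig cU HcU.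
(* With [rho] empty, [U] could only output x, but a single request already produces the output y. *)
have r0 : (0 < r)%N.
  rewrite lt0n; apply/eqP => rE; have rhoE : rho = [::] by apply: size0nil.
  have [||||e He] := force (fun e t => nat_of_bool (t == 0%N)) (fun t => t.+1) _ _ _ R y.
  - by rewrite /cf2; cfauto.
  - by rewrite /cf1; cfauto.
  - by [].
  - move=> e [|T]; first by rewrite big_geq.
    rewrite big_ltn //= big_nat_cond big1 ?addr0; last first.
      by move=> t /andP[/andP[t0 _] _]; rewrite gtn_eqF // mul0r.
    by rewrite mul1r invf_le1 ?expr1 ?ltr0n // ler1n.
  have [HUy _] := He 0%N 0%N isT.
  by have := Urho (sig e ++ tag_prefix e ++ str 1 0); rewrite rhoE cat0s HUy => -[].
exists r, qa, qb, (Kof sig); split=> //.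
- rewrite /cf3 /qa /ext /halts; apply: cf_and; last cfauto.
  by apply: cf_leq; [cfauto|apply: (cf_app2 (cf_run1 cU)); cfauto].
- have Hru : cf 3 (fun u => run cU (nth 0%N u 0) [:: (2 ^ nth 0%N u 1 + nth 0%N u 2).-1]).
    by apply: (cf_app2 (cf_run1 cU)); cfauto.
  rewrite /cf3 /qb /halts /out; apply: cf_and; first by apply: cf_leq; [cfauto|].
  apply: cf_leq; first cfauto; apply: (cf_app2 (cf_run1 cX)); first cfauto.
  exact: cf_pred.
(* A string extending [rho] outputs x, which is in X and never gets enumerated out. *)
- move=> s l v vl /andP[h1 h2]; apply/andP; split=> //; apply/negP => e.
  have [t Ht] : H l v by apply/hP => //; exists s.
  have E : U (str l v) = Some x.
    by move: Ht; rewrite (extE _ _ vl e) Urho; case: (U _).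
  by move: h2; rewrite (outP _ _ _ _ vl h1 E) => h2; have /XP : exists s, (0 < run cX s [:: enc x])%N by exists s.
(* Splitting dom U along [rho] gives m1 = 2^-r m1 + m4, where m1 is the weight of dom U and m4 is
   A. *)
- rewrite EX EA EB; move: S1 S2; rewrite Eext.
  set m1 := meas R _; set m2 := meas R _; set m3 := meas R _; set m4 := meas R _.
  move=> S1 S2.
  have p1 : 2 ^+ r - 1 != 0 :> R.
    rewrite subr_eq0 gt_eqF // exprn_egt1 // ?ltr1n //; by rewrite -lt0n.
  have -> : m2 = m1 - m3 by rewrite S1 addrK.
  congr (_ - _); have -> : m4 = m1 - 2 ^- r * m1 by rewrite {1}S2 addrC addKr.
  by field; rewrite p1 pow2_neq0.
- exact: cf_Kof.
- move=> rq g Hrq Hg gS Hsum.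
  have [e He] := force rq g Hrq Hg gS R y Hsum; exists e => s T.
  apply: (@forced_growth R qa (rq e) (alloc rq g e) g (Kof sig e) (bval (sig e ++ tag_prefix e))) => //.
  + by have := bval_lt (sig e ++ tag_prefix e); rewrite size_cat size_pre.
  + by move=> t; apply: alloc_bound gS R Hsum _ _.
  + move=> t v h; have [h1 _] := He t v h.
    have vl : (v < 2 ^ g t)%N.
      by case/andP: h => _ h; apply: leq_trans h (alloc_bound gS Hsum e t).
    have El : (Kof sig e + g t)%N = (size (sig e ++ tag_prefix e) + g t)%N by rewrite size_cat size_pre.
    have Es : str (Kof sig e + g t) (bval (sig e ++ tag_prefix e) * 2 ^ g t + v) = sig e ++ tag_prefix e ++ str (g t) v.
      by rewrite El -str_cat // catA.
    have vb : (bval (sig e ++ tag_prefix e) * 2 ^ g t + v < 2 ^ (Kof sig e + g t))%N.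
      have b := bval_lt (sig e ++ tag_prefix e); rewrite size_cat size_pre in b.
      rewrite expnD; apply: leq_trans (_ : (bval (sig e ++ tag_prefix e)).+1 * 2 ^ g t <= _)%N.
        by rewrite mulSn; lia.
      by rewrite leq_mul2r b orbT.
    have [s' hs'] : exists s', halts cU s' (Kof sig e + g t) (bval (sig e ++ tag_prefix e) * 2 ^ g t + v).
      by apply/hP => //; exists y; rewrite Es.
    exists s'; rewrite /qa hs' /=; apply/negP => ex.
    have := extE _ _ vb ex; rewrite Es => E.
    by move: h1; rewrite E Urho; case: (U _) => // u [] /esym.
  + by move=> t v /(He t)[_ h] /andP[].
Qed.

(** * Nested frames *)

Section Frames.
Variables (R : realType) (A B : nat -> R) (g : nat -> nat) (E q : nat).

(** Greatest length allowed to a child of a frame started at p. It is fixed by p alone and is tiny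
    against 2^-(p+2), the inverse of the bound on the number of strings of length at most p + 1. *)
Definition cap p : R := 2 ^- (g p.+1).
(** The current length l of the interval [A_s, A_s + l] opened at s inside a frame started at p. *)
Definition len p s t : R := Num.min (cap p) (B t - B s).
(** The last test keeps A_t within the first E/(E+1) of the interval; [E] will be chosen so that
    (E+1)/E = 1 + d/2. *)
Definition alive p s t : bool :=
  [&& (p < s)%N, B s < B t & E.+1%:R * (A t - A s) <= E%:R * len p s t].

(* Start stage of the level [n] frame open at stage [t], or [t] if there is none; the
   level [0] frame is always open. *)
Fixpoint frame n t : nat :=
  match n with
  | 0 => 0%N
  | m.+1 => (fix start t := match t with
             | 0 => 0%N
             | t'.+1 => if alive (frame m t'.+1) (start t') t'.+1 then start t' else t'.+1
             end) t
  end.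

Lemma frameS n t : frame n.+1 t.+1 =
  if alive (frame n t.+1) (frame n.+1 t) t.+1 then frame n.+1 t else t.+1.
Proof. by []. Qed.

Lemma frame_le n t : (frame n t <= t)%N.
Proof. by case: n => // n; elim: t => // t IH; rewrite frameS; case: ifP => // _; rewrite ltnW. Qed.

Lemma frame_lt n t : (frame n.+1 t.+1 < t.+1)%N ->
  frame n.+1 t.+1 = frame n.+1 t /\ alive (frame n t.+1) (frame n.+1 t) t.+1.
Proof. by rewrite frameS; case: ifP => //; rewrite ltnn. Qed.

Lemma frame_const n t u : (frame n t <= u <= t)%N -> frame n u = frame n t.
Proof.
case: n => // n; elim: t u => [|t IH] u /andP[h1].
  by rewrite leqn0 => /eqP->.
rewrite leq_eqVlt => /orP[/eqP->//|ut].
have [E1 _] := frame_lt (leq_ltn_trans h1 ut).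
by rewrite E1; apply: IH; rewrite -E1 h1.
Qed.

Lemma frame_alive n t : (frame n.+1 t < t)%N -> alive (frame n t) (frame n.+1 t) t.
Proof. by case: t => // t h; have [E1] := frame_lt h; rewrite E1. Qed.

Lemma frame_nested n t : (frame n.+1 t < t)%N -> (frame n t < frame n.+1 t)%N.
Proof. by move=> /frame_alive /and3P[]. Qed.

(** Growth at stage t of the open frame of level n + 1. Summed over the stages it gives the total
    length of all frames of that level, and it is also the amount to be requested. *)
Definition inc n t : R :=
  if (frame n.+1 t < t)%N then
    len (frame n t) (frame n.+1 t) t - len (frame n t) (frame n.+1 t) t.-1 else 0.
Definition cost n t : R := \sum_(0 <= u < t.+1) inc n u.

Lemma costS n t : cost n t.+1 = cost n t + inc n t.+1.
Proof. by rewrite /cost big_nat_recr. Qed.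

Lemma cost0 n : cost n 0 = 0.
Proof. by rewrite /cost big_nat1 /inc ltn0. Qed.

Lemma cost_frame n t : (frame n.+1 t < t)%N ->
  cost n t = cost n (frame n.+1 t) + len (frame n t) (frame n.+1 t) t.
Proof.
elim: t => // t IH h; have [E1 _] := frame_lt h.
have h2 := frame_nested h.
have E2 : frame n t = frame n t.+1 by apply: frame_const; move: h2 h; lia.
rewrite costS /inc h E1 -E2 -[t.+1.-1]/t.
have := frame_le n.+1 t; rewrite leq_eqVlt => /orP[/eqP e|lt].
  rewrite e; have -> : len (frame n t) t t = 0.
    rewrite /len subrr; apply/min_idPr; rewrite /cap invr_ge0 exprn_ge0 //.
  by rewrite subr0.
by rewrite (IH lt) -addrA [_ + (_ - _)]addrC subrK.
Qed.

Hypotheses (And : forall s t, (s <= t)%N -> A s <= A t) (A0 : forall t, 0 <= A t)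
  (A1 : forall t, A t <= 1) (Bnd : forall s t, (s <= t)%N -> B s <= B t).
Hypothesis Bgran : forall s t, (s <= t)%N -> B s < B t -> 2 ^- t <= B t - B s.
Variables (N V : nat -> nat -> R).
Hypotheses (Nnd : forall tau s t, (s <= t)%N -> N tau s <= N tau t)
  (N0 : forall tau t, 0 <= N tau t)
  (Nle : forall tau t, N tau t <= 2 ^+ tau.+1)
  (Vnd : forall tau s t, (s <= t)%N -> V tau s <= V tau t)
  (V0 : forall tau t, 0 <= V tau t)
  (VA : forall tau t, (tau <= t)%N -> V tau t <= A t - A tau).
(* [N tau t] counts the short strings (length at most [tau]) contributing to [B t],
   [V tau t] is the weight of the long ones. *)
Hypothesis stock : forall tau s t D, (s <= t)%N -> 0 <= D ->
  Num.min D (B t - B s) <= D * (N tau t - N tau s) + (V tau t - V tau s).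
Hypotheses (E0 : (0 < E)%N) (Eq : (2 * E.+1 <= 2 ^ q)%N).
Hypotheses (g1 : forall s, (s.+2 + q + s.+1 <= g s.+1)%N)
  (g2 : forall p s, (p < s)%N -> (s.+2 + q + g p.+1 <= g s.+1)%N).

Lemma cap_gt0 p : 0 < cap p. Proof. by rewrite invr_gt0 exprn_gt0. Qed.

(** Induction from one child to the preceding one: a child open from u to t is paid by [stock] out
    of the increase of N and V between u and t. Children start after s, hence the threshold s +
    1. *)
Lemma children_cost n s t : frame n t = s -> (s < t)%N ->
  cost n t - cost n s <= cap s * (N s.+1 t - N s.+1 s.+1) + (V s.+1 t - V s.+1 s.+1).
Proof.
move=> Ft st; move: Ft st; have [m] := ubnP t; elim: m t => // m IH t tm Ft st.
have nn u : (s < u)%N -> 0 <= cap s * (N s.+1 u - N s.+1 s.+1) + (V s.+1 u - V s.+1 s.+1).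
  move=> su; apply: addr_ge0; first by apply: mulr_ge0; rewrite ?subr_ge0 ?Nnd // ltW ?cap_gt0.
  by rewrite subr_ge0 Vnd.
have := frame_le n.+1 t; rewrite leq_eqVlt => /orP[/eqP e|lt].
  case: t => // t in tm Ft st e *.
  have -> : cost n t.+1 = cost n t by rewrite costS /inc e ltnn addr0.
  move: st; rewrite ltnS leq_eqVlt => /orP[/eqP<-|st].
    by rewrite subrr nn.
  have Ft' : frame n t = s by rewrite -Ft; apply: frame_const; rewrite Ft; lia.
  apply: le_trans (IH t _ Ft' st) _; first lia.
  apply: lerD; first by rewrite ler_pM2l ?cap_gt0 // lerD2r Nnd.
  by rewrite lerD2r Vnd.
have s1 := frame_nested lt; rewrite Ft in s1.
rewrite (cost_frame lt) Ft; set u := frame n.+1 t in lt s1 *.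
have Fu : frame n u = s by rewrite -Ft; apply: frame_const; rewrite Ft; lia.
have := IH u _ Fu s1; have -> : (u < m)%N by lia.
move=> /(_ isT) H1; have H2 := @stock s.+1 u t (cap s) (ltnW lt) (ltW (cap_gt0 s)).
rewrite /len; lra.
Qed.

Lemma children_cost_le n s t : frame n t = s -> (s < t)%N ->
  cost n t - cost n s <= cap s * 2 ^+ s.+2 + (A t - A s).
Proof.
move=> Ft st; apply: le_trans (children_cost Ft st) _; apply: lerD.
  rewrite ler_pM2l ?cap_gt0 //; apply: le_trans (Nle s.+1 t).
  by rewrite lerBlDr lerDl N0.
have := VA st; have := V0 s.+1 s.+1; have := And (leqnSn s); lra.
Qed.

(** The total charge for short strings is negligible against the frame: its length is at least the
    smaller of [cap] of the parent and 2^-(s+1), and [g1], [g2] make [cap s] small against both. *)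
Lemma frame_len n t : (frame n.+1 t < t)%N ->
  cap (frame n.+1 t) * 2 ^+ (frame n.+1 t).+2 <= 2 ^- q * len (frame n t) (frame n.+1 t) t.
Proof.
move=> lt; have nest := frame_nested lt.
set s := frame n.+1 t in lt nest *; set p := frame n t in nest *.
(* The frame was already alive at stage s + 1, so B grew by then, by at least 2^-(s+1). *)
have /frame_alive : (frame n.+1 s.+1 < s.+1)%N.
  by rewrite (@frame_const n.+1 t) // -/s; lia.
rewrite (@frame_const n.+1 t) -/s; last lia.
rewrite (@frame_const n t) -/p; last lia.
move=> /and3P[_ Bs _].
have b1 : 2 ^- s.+1 <= B t - B s.
  by apply: le_trans (Bgran (leqnSn s) Bs) _; rewrite lerD2r Bnd.
have pw (i j k : nat) : (i + j <= k)%N -> (2 ^- k * 2 ^+ i <= 2 ^- j :> R).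
  move=> h; rewrite -ler_pdivlMr ?exprn_gt0 // -invfM -exprD.
  by rewrite lef_pV2 ?posrE ?exprn_gt0 // ler_weXn2l ?ler1n // addnC.
have h1 : cap s * 2 ^+ s.+2 <= 2 ^- (q + g p.+1) by apply: pw; rewrite addnA; exact: g2.
have h2 : cap s * 2 ^+ s.+2 <= 2 ^- (q + s.+1) by apply: pw; rewrite addnA; exact: g1.
rewrite -ler_pdivrMl ?invr_gt0 ?exprn_gt0 // invrK le_min; apply/andP; split.
  rewrite -ler_pdivlMl ?exprn_gt0 // /cap; apply: le_trans h1 _.
  by rewrite exprD invfM.
rewrite -ler_pdivlMl ?exprn_gt0 //; apply: le_trans h2 _.
by rewrite exprD invfM ler_pM2l ?invr_gt0 ?exprn_gt0.
Qed.

(** Ratio between consecutive levels: long strings cost at most E/(E+1) of a frame and short ones at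
    most 2^-q of it. *)
Definition theta : R := 1 - 2 ^- q.

Lemma theta_ge : E%:R / E.+1%:R + 2 ^- q <= theta.
Proof.
have h : 2 ^- q * 2 <= E.+1%:R^-1 :> R.
  rewrite -ler_pdivlMr // -invfM lef_pV2 ?posrE ?exprn_gt0 ?mulr_gt0 ?ltr0n //.
  by rewrite -natrX mulrC -natrM ler_nat.
have -> : E%:R / E.+1%:R = 1 - E.+1%:R^-1 :> R.
  by rewrite -natr1; field; rewrite natr1 pnatr_eq0.
rewrite /theta; move: h; set x := E.+1%:R^-1; set y := 2 ^- q; lra.
Qed.

Lemma theta_ge0 : 0 <= theta.
Proof.
rewrite subr_ge0 invf_le1 ?exprn_gt0 // exprn_ege1 // ler1n //.
Qed.

(** Inside an open frame the children cost at most theta times its length; the past before its start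
    is the induction hypothesis. While no frame of level n + 1 is open, neither side changes. *)
Lemma cost_level n t : cost n.+1 t <= theta * cost n t.
Proof.
have [m] := ubnP t; elim: m t => // m IH t tm.
have := frame_le n.+1 t; rewrite leq_eqVlt => /orP[/eqP e|lt].
  case: t => [|t] in tm e *; first by rewrite !cost0 mulr0.
  have e2 : frame n.+2 t.+1 = t.+1.
    have := frame_le n.+2 t.+1; rewrite leq_eqVlt => /orP[/eqP//|lt2].
    by have := frame_nested lt2; rewrite e; lia.
  by rewrite !costS /inc e e2 ltnn !addr0; apply: IH.
rewrite (cost_frame lt).
have H1 := children_cost_le erefl lt.
have /and3P[_ _ H2] := frame_alive lt.
have H3 := frame_len lt.
have H4 := IH (frame n.+1 t); have {}H4 := H4 ltac:(lia).
set s := frame n.+1 t in H1 H2 H3 H4 *; set l := len _ _ _ in H2 H3 *.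
have H5 : A t - A s <= E%:R / E.+1%:R * l.
  by rewrite mulrAC ler_pdivlMr ?ltr0n // mulrC.
have l0 : 0 <= l.
  rewrite /l /len le_min (ltW (cap_gt0 _)) subr_ge0 Bnd //; exact: ltnW.
have H6 : E%:R / E.+1%:R * l + 2 ^- q * l <= theta * l.
  by rewrite -mulrDl ler_wpM2r // theta_ge.
rewrite mulrDr; move: H1 H3 H4 H5 H6; clear H2.
set a := cap s * _; set b := 2 ^- q * l; set c := E%:R / E.+1%:R * l.
set d := theta * _; set e := theta * l; lra.
Qed.

Lemma cost_bound n t : cost n t <= 2 * theta ^+ n.
Proof.
elim: n => [|n IH]; last first.
  apply: le_trans (cost_level n t) _; rewrite exprS mulrCA ler_wpM2l //; exact: theta_ge0.
rewrite expr0 mulr1; case: t => [|t]; first by rewrite cost0.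
have := @children_cost_le 0 0 t.+1 erefl isT; rewrite cost0 subr0.
have := A1 t.+1; have := A0 0; have : cap 0 * 2 ^+ 2 <= 1.
  rewrite ler_pdivrMl ?exprn_gt0 // mulr1 ler_weXn2l ?ler1n //.
  by have := g1 0; lia.
lra.
Qed.

Variables Ai Bi : R.
Hypotheses (Acvg : (A @ \oo --> Ai)%classic) (Bcvg : (B @ \oo --> Bi)%classic).

Lemma A_le_lim t : A t <= Ai.
Proof.
rewrite -(cvg_lim _ Acvg) //; apply: nondecreasing_cvgn_le; first by move=> s u; exact: And.
by apply/cvg_ex; exists Ai.
Qed.
Lemma cvg_seq_near (u : nat -> R) (l e : R) : (u @ \oo --> l)%classic -> 0 < e ->
  exists T, forall t, (T <= t)%N -> `|l - u t| < e.
Proof. by move=> /cvgrPdist_lt /(_ e) H /H [T _ HT]; exists T => t /HT. Qed.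

Hypothesis often : forall T, exists s, (T <= s)%N /\ E.+1%:R * (Ai - A s) < E%:R * (Bi - B s).

(** If the frames of level n + 1 inside a permanent parent kept closing, the potential [h] would
    stay at or above its limit from some stage on, against [often], which says that [h] is below its
    limit infinitely often. *)
Lemma frame_permanent n : exists s T, (s < T)%N /\ forall t, (T <= t)%N -> frame n t = s.
Proof.
elim: n => [|n [p [T [pT HT]]]]; first by exists 0%N, 1%N.
apply: contrapT => Hno.
have lev T' : exists u, (T' <= u)%N /\ frame n.+1 u = u.
  apply: contrapT => Hu; apply: Hno.
  exists (frame n.+1 T'), T'; split.
    have := frame_le n.+1 T'; rewrite leq_eqVlt => /orP[/eqP e|//].
    by case: Hu; exists T'.
  move=> t T't; elim: t T't => [|t IH].
    by rewrite leqn0 => /eqP ->.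
  rewrite leq_eqVlt => /orP[/eqP->//|]; rewrite ltnS => Tt; rewrite -(IH Tt).
  have := frame_le n.+1 t.+1; rewrite leq_eqVlt => /orP[/eqP e|/frame_lt[]//].
  by case: Hu; exists t.+1; split=> //; lia.
(* While a frame is open, [h] is at least its value at the start. Once A is too close to its limit
   to outrun the cap, a restart cannot raise [h]. So [h] at successive starts decreases to the limit
   [hi]. *)
pose h t := E%:R * B t - E.+1%:R * A t.
pose hi := E%:R * Bi - E.+1%:R * Ai.
have Epos : 0 < E%:R :> R by rewrite ltr0n.
have E1pos : 0 < E.+1%:R :> R by rewrite ltr0n.
have e0 : 0 < E%:R * cap p / E.+1%:R by rewrite divr_gt0 ?mulr_gt0 ?cap_gt0.
have [T1 HT1] := cvg_seq_near Acvg e0.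
have [u0 [u0T Fu0]] := lev (maxn T T1).
have Tu0 : (T <= u0)%N by lia.
have T1u0 : (T1 <= u0)%N by lia.
have capA s t : (u0 <= s)%N -> E.+1%:R * (A t - A s) < E%:R * cap p.
  move=> us; have := HT1 s (leq_trans T1u0 us).
  rewrite ger0_norm ?subr_ge0 ?A_le_lim // ltr_pdivlMr // mulrC => hlt.
  apply: le_lt_trans hlt; rewrite ler_pM2l // lerD2r; exact: A_le_lim.
have ge_u0 t : (u0 <= t)%N -> (u0 <= frame n.+1 t)%N.
  elim: t => [|t IH]; first by rewrite leqn0 => /eqP <-.
  rewrite leq_eqVlt => /orP[/eqP<-|]; first by rewrite Fu0.
  rewrite ltnS => ut; rewrite frameS; case: ifP => _; [exact: IH|exact: leqW].
have hH t : h (frame n.+1 t) <= h t.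
  have := frame_le n.+1 t; rewrite leq_eqVlt => /orP[/eqP->//|/frame_alive /and3P[_ _]].
  rewrite /len => al; have : E%:R * Num.min (cap (frame n t)) (B t - B (frame n.+1 t)) <=
     E%:R * (B t - B (frame n.+1 t)) by rewrite ler_pM2l // ge_min lexx orbT.
  rewrite /h; lra.
have Hnd t : (u0 <= t)%N -> h (frame n.+1 t.+1) <= h (frame n.+1 t).
  move=> ut; rewrite frameS; case: ifP => // /negbT.
  set s := frame n.+1 t; have us : (u0 <= s)%N by exact: ge_u0.
  have st : (s <= t)%N by exact: frame_le.
  rewrite HT; last lia.
  rewrite /alive; have -> /= : (p < s)%N by lia.
  case: (ltrP (B s) (B t.+1)) => /= Bst.
    rewrite -ltNge /len; case: (lerP (cap p) (B t.+1 - B s)) => _ al.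
      by have := capA s t.+1 us; lra.
    rewrite /h; lra.
  have Be : B t.+1 = B s by apply/eqP; rewrite eq_le Bst Bnd // leqW.
  by rewrite /h Be lerD2l lerN2 ler_pM2l // And // leqW.
have Hnd2 t t' : (u0 <= t)%N -> (t <= t')%N -> h (frame n.+1 t') <= h (frame n.+1 t).
  move=> ut tt'; rewrite -(subnK tt'); elim: (t' - t)%N => // k IH.
  by rewrite addSn; apply: le_trans IH; apply: Hnd; lia.
have hcvg : (h @ \oo --> hi)%classic.
  by apply: cvgB; apply: cvgMr.
have Hge t : (u0 <= t)%N -> hi <= h (frame n.+1 t).
  move=> ut; rewrite leNgt; apply/negP => lt.
  have [T2 HT2] := cvg_seq_near hcvg (ltac:(rewrite subr_gt0; exact: lt) : 0 < hi - h (frame n.+1 t)).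
  have [u [uT Fu]] := lev (maxn t T2).
  have : h u <= h (frame n.+1 t) by rewrite -{1}Fu; apply: Hnd2; lia.
  have := HT2 u ltac:(lia); have := ler_norm (hi - h u); lra.
have [s [us]] := often u0.
have := hH s; have := Hge s us; rewrite /h /hi; lra.
Qed.

(** For a permanent frame started at s, forcing gives length at most Ai - A s, and survival keeps
    A_t - A s within E/(E+1) of that. In the limit Ai - A s would be at most E/(E+1) of itself,
    although it is positive. *)
Lemma not_often n : 
  (forall s T, A s + \sum_(s <= t < T) inc n t <= Ai) -> False.
Proof.
move=> force; have [s [T [sT HT]]] := frame_permanent n.+1.
have al t : (T <= t)%N -> alive (frame n t) s t.
  by move=> Tt; have := @frame_alive n t; rewrite HT //; apply; lia.
have H1 t : (T <= t)%N -> E.+1%:R * (A t - A s) <= E%:R * (Ai - A s).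
  move=> Tt; have /and3P[_ _] := al t Tt; move=> h; apply: le_trans h _.
  rewrite ler_pM2l ?ltr0n //; have := force s.+1 t.+1.
  have : (frame n.+1 t < t)%N by rewrite HT //; lia.
  move=> /cost_frame; rewrite HT //.
  rewrite /cost (big_cat_nat (n := s.+1)) //=; last lia.
  have := And (leqnSn s); lra.
have D0 : 0 < Ai - A s.
  have /and3P[_ Bs] := al T (leqnn T); rewrite /len => h.
  have : 0 < len (frame n T) s T by rewrite /len lt_min cap_gt0 subr_gt0.
  have := force s.+1 T.+1; have : (frame n.+1 T < T)%N by rewrite HT.
  move=> /cost_frame; rewrite HT // /cost (big_cat_nat (n := s.+1)) //=; last lia.
  have := And (leqnSn s); lra.
have [T1 HT1] := cvg_seq_near Acvg (divr_gt0 D0 (ltr0Sn R E)).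
have := HT1 (maxn T T1) (leq_maxr _ _); have := H1 (maxn T T1) (leq_maxl _ _).
rewrite ger0_norm ?subr_ge0 ?A_le_lim // ltr_pdivlMr ?ltr0n // -natr1; lra.
Qed.
End Frames.

Lemma bernoulli_le (R : realType) (x : R) n : 0 <= x <= 1 -> (1 - x) ^+ n * (1 + n%:R * x) <= 1.
Proof.
move=> /andP[x0 x1]; elim: n => [|n IH]; first by rewrite expr0 mul0r addr0 mulr1.
apply: le_trans IH; rewrite exprSr -mulrA; apply: ler_wpM2l.
  by rewrite exprn_ge0 // subr_ge0.
rewrite -natr1; have : 0 <= n%:R * x * x by rewrite !mulr_ge0.
by have := mulr_ge0 x0 x0; rewrite !mulrDl !mulrDr; lra.
Qed.

(** Bernoulli with x = 2^-q and exponent 2^q shows that 2^q levels halve the total; one extra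
    halving absorbs the initial bound 2. *)
Lemma theta_exp (R : realType) q k : 2 ^+ k * (2 * theta R q ^+ (k.+1 * 2 ^ q)) <= 1 :> R.
Proof.
have H : theta R q ^+ (2 ^ q) <= 2^-1.
  have h : 0 <= (2 ^- q : R) <= 1.
    by rewrite invr_ge0 exprn_ge0 // invf_le1 ?exprn_gt0 // exprn_ege1 // ler1n.
  have := bernoulli_le (2 ^ q) h; rewrite natrX2 mulfV ?pow2_neq0 // -/(theta R q).
  by rewrite -[1 + 1]/(2 : R) => {}h; rewrite -ler_pdivlMr // mul1r in h.
rewrite mulrA -exprSr mulnC exprM; apply: le_trans (_ : 2 ^+ k.+1 * 2^-1 ^+ k.+1 <= _).
  rewrite ler_pM2l ?exprn_gt0 // lerXn2r ?nnegrE ?exprn_ge0 ?theta_ge0 // invr_ge0 //.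
by rewrite -exprMn mulfV ?pnatr_eq0 ?expr1n.
Qed.

(** * Short and long strings in the growth of B *)

Section Stock.
Variables (R : realType) (qa qb : nat -> nat -> nat -> bool).
Hypotheses (nda : nondec_stage qa) (ndb : nondec_stage qb)
  (sub : forall s l v, (v < 2 ^ l)%N -> qb s l v -> qa s l v).

Definition trunc_cnt (q : nat -> nat -> nat -> bool) t l : nat :=
  if (l <= t)%N then (\sum_(0 <= v < 2 ^ l) q t l v)%N else 0%N.

Lemma trunc_cnt_nd q s t l : nondec_stage q -> (s <= t)%N -> (trunc_cnt q s l <= trunc_cnt q t l)%N.
Proof.
move=> nd st; rewrite /trunc_cnt; case: (leqP l s) => // ls; rewrite (leq_trans ls st).
by apply: leq_sum => v _; case E: (q s l v) => //; rewrite (nd s t).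
Qed.

Lemma trunc_cnt_sub t l : (trunc_cnt qb t l <= trunc_cnt qa t l)%N.
Proof.
rewrite /trunc_cnt; case: ifP => // _; rewrite [leqLHS]big_nat_cond [leqRHS]big_nat_cond.
apply: leq_sum => v /andP[/andP[_ vl] _]; case E: (qb t l v) => //.
by rewrite (sub vl E).
Qed.

Lemma trunc_cnt_le q t l : (trunc_cnt q t l <= 2 ^ l)%N.
Proof.
rewrite /trunc_cnt; case: ifP => // _; apply: (@leq_trans (\sum_(0 <= v < 2 ^ l) 1)%N).
  by apply: leq_sum => v _; case: (q t l v).
by rewrite sum_nat_const_nat; lia.
Qed.

Lemma weight_trunc q t n : (t < n)%N -> weight R q t = \sum_(0 <= l < n) (trunc_cnt q t l)%:R / 2 ^+ l.
Proof. exact: weight_E_wide. Qed.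

Definition shortN tau t : nat := (\sum_(0 <= l < tau.+1) trunc_cnt qb t l)%N.
Definition longV tau t : R := \sum_(tau.+1 <= l < (tau + t).+1) (trunc_cnt qb t l)%:R / 2 ^+ l.

Lemma longV_wide tau t n : (tau + t <= n)%N ->
  longV tau t = \sum_(tau.+1 <= l < n.+1) (trunc_cnt qb t l)%:R / 2 ^+ l.
Proof.
move=> tn; rewrite /longV [RHS](big_cat_nat (n := (tau + t).+1)) //=; last lia.
rewrite [X in _ = _ + X]big_nat_cond [X in _ = _ + X]big1 ?addr0 // => l /andP[/andP[h _] _].
by rewrite /trunc_cnt leqNgt (_ : (t < l)%N) ?mul0r //; lia.
Qed.

Lemma term_ge0 (n l : nat) : 0 <= n%:R / 2 ^+ l :> R.
Proof. by rewrite divr_ge0 // ltW ?pow2_gt0. Qed.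

Lemma shortN_nd tau s t : (s <= t)%N -> (shortN tau s <= shortN tau t)%N.
Proof. by move=> st; apply: leq_sum => l _; exact: trunc_cnt_nd. Qed.

Lemma shortN_le tau t : (shortN tau t <= 2 ^ tau.+1)%N.
Proof.
apply: (@leq_trans (\sum_(0 <= l < tau.+1) 2 ^ l)%N).
  by apply: leq_sum => l _; exact: trunc_cnt_le.
elim: tau => [|tau IH]; first by rewrite big_nat1.
by rewrite big_nat_recr //= [(2 ^ tau.+2)%N]expnS; lia.
Qed.

Lemma longV_nd tau s t : (s <= t)%N -> longV tau s <= longV tau t.
Proof.
move=> st; rewrite (@longV_wide tau s (tau + t)); last lia.
apply: ler_sum => l _; rewrite ler_pM2r ?invr_gt0 ?pow2_gt0 // ler_nat; exact: trunc_cnt_nd.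
Qed.

Lemma longV_ge0 tau t : 0 <= longV tau t.
Proof. by apply: sumr_ge0 => l _; exact: term_ge0. Qed.

Lemma longV_le tau t : (tau <= t)%N -> longV tau t <= weight R qa t - weight R qa tau.
Proof.
move=> tt; rewrite lerBrDl (@weight_trunc qa t (tau + t).+1); last lia.
rewrite (big_cat_nat (n := tau.+1)) //=; last lia.
rewrite (@weight_trunc qa tau tau.+1) // lerD //; apply: ler_sum => l _.
  by rewrite ler_pM2r ?invr_gt0 ?pow2_gt0 // ler_nat trunc_cnt_nd.
by rewrite ler_pM2r ?invr_gt0 ?pow2_gt0 // ler_nat trunc_cnt_sub.
Qed.

(** Either a new short string has appeared, and one unit of N pays for the whole of [D], or all the
    growth comes from long strings. *)
Lemma stock_bound tau s t (D : R) : (s <= t)%N -> 0 <= D ->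
  Num.min D (weight R qb t - weight R qb s) <=
  D * ((shortN tau t)%:R - (shortN tau s)%:R) + (longV tau t - longV tau s).
Proof.
(* Equality of the totals forces equality at every length, since each count is nondecreasing. *)
move=> st D0; have := shortN_nd tau st; rewrite leq_eqVlt => /orP[/eqP e|lt].
  rewrite e subrr mulr0 add0r ge_min; apply/orP; right.
  have el l : (l < tau.+1)%N -> trunc_cnt qb s l = trunc_cnt qb t l.
    move=> lt; move: e; rewrite /shortN !big_mkord.
    have h (i : 'I_tau.+1) : true -> (trunc_cnt qb s i <= trunc_cnt qb t i ?= iff (trunc_cnt qb s i == trunc_cnt qb t i))%N.
      by move=> _; split=> //; exact: trunc_cnt_nd.
    have [_] := leqif_sum h; move=> eq /eqP; rewrite eq => /forallP /(_ (Ordinal lt)) /eqP.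
    by [].
  rewrite (@weight_trunc qb t (tau + t).+1); last lia.
  rewrite (@weight_trunc qb s (tau + t).+1); last lia.
  rewrite (@longV_wide tau s (tau + t)); last lia.
  rewrite (big_cat_nat (n := tau.+1)) //=; last lia.
  rewrite [X in _ - X <= _](big_cat_nat (n := tau.+1)) //=; last lia.
  rewrite -/(longV tau t); set x := (X in _ - (X + _) <= _); set y := (X in X + _ - _ <= _).
  have -> : y = x by apply: eq_big_nat => l /andP[_ lt]; rewrite el.
  lra.
apply: le_trans (_ : D <= _); first by rewrite ge_min lexx.
have := longV_nd tau st; have : D * 1 <= D * ((shortN tau t)%:R - (shortN tau s)%:R).
  by rewrite ler_wpM2l // lerBrDr nat1r ler_nat; lia.
lra.
Qed.

Lemma weight_scale q s t : (s <= t)%N -> weight R q s = (weight_num q s * 2 ^ (t - s))%N%:R / 2 ^+ t.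
Proof.
move=> st; have -> : 2 ^+ t = 2 ^+ (t - s) * 2 ^+ s :> R by rewrite -exprD subnK.
by rewrite natrM natrX2 invfM mulrA mulfK ?pow2_neq0.
Qed.

Lemma weight_gran q s t : (s <= t)%N -> weight R q s < weight R q t -> 2 ^- t <= weight R q t - weight R q s.
Proof.
move=> st; rewrite (weight_scale q st) /weight ltr_pM2r ?invr_gt0 ?pow2_gt0 // ltr_nat => h.
by rewrite -mulrBl ler_peMl ?invr_ge0 ?exprn_ge0 // lerBrDr nat1r ler_nat; lia.
Qed.

End Stock.

Lemma cf_weight_num q : cf3 (fun s l v => nat_of_bool (q s l v)) -> cf1 (weight_num q).
Proof.
move=> Hq; apply: (@cf_sum _ _ (fun l u =>
  ((\sum_(0 <= v < 2 ^ l) q (nth 0 u 0) l v) * 2 ^ (nth 0 u 0 - l))%N)); first cfauto.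
apply: cf_mul; last cfauto.
apply: (@cf_sum _ _ (fun v u => nat_of_bool (q (nth 0 (behead u) 0) (nth 0 u 0) v)%N)); first cfauto.
by apply: (cf_app3 Hq); cfauto.
Qed.

(** * Growth of B eventually dominated by growth of A *)

Section Gap.
Variables (R : realType) (z : R) (r : nat) (qa qb : nat -> nat -> nat -> bool) (K : nat -> nat).
Hypothesis hs : halting_system z r qa qb K.

(** With d = 1/(2^r - 1) this is 2/d, so (E+1)/E = 1 + d/2; then 2(E+1) is less than 2^(r+2), whence
    [qexp]. *)
Definition Ecoef : nat := (2 * (2 ^ r - 1))%N.
Definition qexp : nat := r.+2.
(** Quadratic, so that consecutive values differ by the linear margin demanded in [gran2]. *)
Definition gran (t : nat) : nat := ((t + qexp.+2) ^ 2)%N.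

Let A := weight R qa.
Let B := weight R qb.
Let Ai := meas R (stage_limit qa).
Let Bi := meas R (stage_limit qb).
Let fr := frame A B gran Ecoef.

Lemma bdb : bounded_meas R (stage_limit qb).
Proof.
apply: sub_bounded (hs_bda hs) => l v vl [s h]; exists s; exact: hs_sub hs _ _ _ vl h.
Qed.

Lemma granS t : (gran t < gran t.+1)%N.
Proof. by rewrite /gran ltn_exp2r. Qed.
Lemma gran_mono s t : (s <= t)%N -> (gran s <= gran t)%N.
Proof. by move=> st; rewrite /gran leq_exp2r // leq_add2r. Qed.
Lemma gran_ge t : (t <= gran t)%N.
Proof. by rewrite /gran; nia. Qed.
Lemma gran1 s : (s.+2 + qexp + s.+1 <= gran s.+1)%N.
Proof. by rewrite /gran; nia. Qed.
Lemma gran2 p s : (p < s)%N -> (s.+2 + qexp + gran p.+1 <= gran s.+1)%N.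
Proof. by rewrite /gran; nia. Qed.

Lemma cf_gran : cf1 gran.
Proof. by rewrite /cf1 /gran; cfauto. Qed.

(* The suffix [N] marks values at stage [t] in units of [2 ^ - gran t]. *)
Definition unitN (q : nat -> nat -> nat -> bool) t s : nat := (weight_num q s * 2 ^ (gran t - s))%N.
Definition lenN t u p s : nat := minn (2 ^ (gran t - gran p.+1)) (unitN qb t u - unitN qb t s).
Definition aliveN t p s : bool := [&& (p < s)%N, (unitN qb t s < unitN qb t t)%N
  & (Ecoef.+1 * (unitN qa t t - unitN qa t s) <= Ecoef * lenN t t p s)%N].

Lemma unitNE q t s : (s <= t)%N -> (unitN q t s)%:R / 2 ^+ gran t = weight R q s.
Proof. by move=> st; rewrite (@weight_scale R q s (gran t)) // (leq_trans st) // gran_ge. Qed.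

Lemma unitN_nd q t s u : nondec_stage q -> (s <= u)%N -> (u <= t)%N -> (unitN q t s <= unitN q t u)%N.
Proof.
move=> nd su ut; rewrite -(ler_nat R) -(ler_pM2r (x := (2 ^+ gran t)^-1)) ?invr_gt0 ?pow2_gt0 //.
by rewrite !unitNE ?weight_nd //; lia.
Qed.

Lemma lenNE t u p s : (p < t)%N -> (s <= u)%N -> (u <= t)%N ->
  (lenN t u p s)%:R / 2 ^+ gran t = len B gran p s u.
Proof.
move=> pt su ut; rewrite /lenN /len /cap natr_min minr_pMl ?invr_ge0 ?exprn_ge0 //; congr Num.min.
  have e : 2 ^+ gran t = 2 ^+ (gran t - gran p.+1) * 2 ^+ gran p.+1 :> R.
    by rewrite -exprD subnK // gran_mono.
  by rewrite e natrX2 invfM mulrA mulfV ?pow2_neq0 // mul1r.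
by rewrite natrB ?(unitN_nd (hs_ndb hs)) // mulrBl !unitNE //; lia.
Qed.

Lemma aliveNE t p s : (s < t)%N -> aliveN t p s = alive A B gran Ecoef p s t.
Proof.
move=> st; rewrite /aliveN /alive; case: (ltnP p s) => //= ps; congr (_ && _).
  by rewrite -(ltr_nat R) -(ltr_pM2r (x := (2 ^+ gran t)^-1)) ?invr_gt0 ?pow2_gt0 // !unitNE // ltnW.
rewrite -(ler_nat R) -(ler_pM2r (x := (2 ^+ gran t)^-1)) ?invr_gt0 ?pow2_gt0 //.
rewrite !natrM -!mulrA lenNE //; try lia.
by rewrite natrB ?(unitN_nd (hs_nda hs)) // ?mulrBl ?unitNE //; lia.
Qed.

Lemma cf_unitN q : cf3 (fun s l v => nat_of_bool (q s l v)) -> cf2 (unitN q).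
Proof.
move=> /cf_weight_num Hq; apply: cf_mul; first by apply: (cf_app1 Hq); cfauto.
by apply: cf_exp; [cfauto|apply: cf_sub; [apply: (cf_app1 cf_gran)|]; cfauto].
Qed.

Lemma cf_lenN : cf4 lenN.
Proof.
have Hb := cf_unitN (hs_cfb hs).
apply: cf_min; last by apply: cf_sub; apply: (cf_app2 Hb); cfauto.
by apply: cf_exp; [cfauto|apply: cf_sub; apply: (cf_app1 cf_gran); cfauto].
Qed.

Lemma cf_aliveN : cf3 (fun t p s => nat_of_bool (aliveN t p s)).
Proof.
have Hb := cf_unitN (hs_cfb hs); have Ha := cf_unitN (hs_cfa hs).
apply: cf_and; first cfauto.
apply: cf_and; first by apply: cf_leq; [apply: cf_succ|]; apply: (cf_app2 Hb); cfauto.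
apply: cf_leq.
  by apply: cf_mul; [cfauto|apply: cf_sub; apply: (cf_app2 Ha); cfauto].
by apply: cf_mul; [cfauto|apply: (cf_app4 cf_lenN); cfauto].
Qed.

(** The recursion descends both in the level and in the stage, which is the shape of [cf_table];
    [aliveN] decides the real inequalities in integers. *)
Lemma cf_frame : cf2 fr.
Proof.
pose f (n t x y : nat) := if aliveN t.+1 x y then y else t.+1.
have Hf : cf4 f.
  by apply: cf_if; [apply: (cf_app3 cf_aliveN); cfauto|cfauto|cfauto].
apply: (cf_table Hf) => //; first by case.
  by move=> n t; rewrite /f aliveNE // ltnS; exact: frame_le.
by move=> n t; exact: frame_le.
Qed.

Definition incN n t : nat :=
  if (fr n.+1 t < t)%N then (lenN t t (fr n t) (fr n.+1 t) - lenN t t.-1 (fr n t) (fr n.+1 t))%N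
  else 0%N.

Lemma incNE n t : (incN n t)%:R / 2 ^+ gran t = inc A B gran Ecoef n t.
Proof.
rewrite /incN /inc -/fr; case: ifP => h; last by rewrite mul0r.
have nest := frame_nested h; rewrite -/fr in nest.
rewrite natrB; last first.
  rewrite /lenN leq_min geq_minl /= (leq_trans (geq_minr _ _)) // leq_sub2r //.
  by rewrite (unitN_nd (hs_ndb hs)) // leq_pred.
by rewrite mulrBl !lenNE //; lia.
Qed.

Lemma cf_incN : cf2 incN.
Proof.
have F k n t : cf k n -> cf k t -> cf k (fun v => fr (n v) (t v)) by exact: (cf_app2 cf_frame).
apply: cf_if; last cfauto.
  by apply: cf_leq; [apply: cf_succ; apply: F; cfauto|cfauto].
by apply: cf_sub; apply: (cf_app4 cf_lenN); do ?[cfauto|apply: F].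
Qed.

(* Otherwise permanent frames of every depth exist, and the requests given by a deep
   enough level of frames contradict [hs_force]. *)
Lemma eventual_gap : exists s1, forall s, (s1 <= s)%N ->
  Ecoef%:R * (Bi - B s) <= Ecoef.+1%:R * (Ai - A s).
Proof.
apply: contrapT => Hno.
have often T : exists s, (T <= s)%N /\ Ecoef.+1%:R * (Ai - A s) < Ecoef%:R * (Bi - B s).
  apply: contrapT => H; apply: Hno; exists T => s Ts; rewrite leNgt; apply/negP => lt.
  by apply: H; exists s.
have r0 := hs_r hs.
have E0 : (0 < Ecoef)%N.
  by rewrite /Ecoef muln_gt0 /= subn_gt0 -{1}(expn0 2) ltn_exp2l.
have Eq : (2 * Ecoef.+1 <= 2 ^ qexp)%N.
  by rewrite /Ecoef /qexp !expnS; have := expn_gt0 2 r; lia.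
have And : forall s t, (s <= t)%N -> A s <= A t by exact: weight_nd (hs_nda hs).
have Bnd : forall s t, (s <= t)%N -> B s <= B t by exact: weight_nd (hs_ndb hs).
have A0 t : 0 <= A t by rewrite /A /weight term_ge0.
have A1 t : A t <= 1.
  exact: le_trans (weight_le_meas t (hs_nda hs) (hs_bda hs)) (meas_le1 (hs_bda hs)).
have Bgran s t : (s <= t)%N -> B s < B t -> 2 ^- t <= B t - B s by exact: weight_gran.
have Acvg : (A @ \oo --> Ai)%classic by exact: weight_cvg (hs_nda hs) (hs_bda hs).
have Bcvg : (B @ \oo --> Bi)%classic by exact: weight_cvg (hs_ndb hs) bdb.
have Nnd tau s t : (s <= t)%N -> (shortN qb tau s)%:R <= (shortN qb tau t)%:R :> R.
  by move=> st; rewrite ler_nat (shortN_nd (hs_ndb hs)).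
have N0 tau t : 0 <= (shortN qb tau t)%:R :> R by [].
have Nle tau t : (shortN qb tau t)%:R <= 2 ^+ tau.+1 :> R.
  by rewrite -natrX2 ler_nat shortN_le.
have Vnd := longV_nd R (hs_ndb hs).
have V0 := @longV_ge0 R qb.
have VA := longV_le R (hs_nda hs) (hs_sub hs).
have stock := @stock_bound R qb (hs_ndb hs).
(* Deep enough that the frames of the next level have total length at most 2^-(K e), which leaves
   room for the factor 2^(K e) lost in serving. *)
pose lev e := ((K e).+1 * 2 ^ qexp)%N.
pose rq e t := (2 ^ K e * incN (lev e) t)%N.
have rqE e t : (rq e t)%:R / 2 ^+ gran t = 2 ^+ K e * inc A B gran Ecoef (lev e) t.
  by rewrite /rq natrM natrX2 -mulrA incNE.
have [||||e He] := hs_force hs (rq := rq) (g := gran).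
- rewrite /cf2 /rq; have HK k f : cf k f -> cf k (fun v => K (f v)) by exact: (cf_app1 (hs_cfK hs)).
  apply: cf_mul; first by apply: cf_exp; [cfauto|apply: HK; cfauto].
  apply: (cf_app2 cf_incN); last cfauto.
  by apply: cf_mul; [apply: cf_succ; apply: HK; cfauto|cfauto].
- exact: cf_gran.
- exact: granS.
- move=> e T; under eq_bigr do rewrite rqE; rewrite -big_distrr /=.
  apply: le_trans (theta_exp R qexp (K e)); rewrite ler_pM2l ?exprn_gt0 //.
  case: T => [|T].
    by rewrite big_geq // mulr_ge0 // exprn_ge0 // theta_ge0.
  exact: (cost_bound And A0 A1 Bnd Bgran Nnd N0 Nle Vnd V0 VA stock E0 Eq gran1 gran2).
apply: (@not_often R A B gran Ecoef qexp And Bnd E0 Eq Ai Bi Acvg Bcvg often (lev e)) => s T.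
have := He s T; under eq_bigr do rewrite rqE; rewrite -big_distrr /= mulrAC.
by rewrite mulfV ?pow2_neq0 // mul1r.
Qed.

End Gap.

Lemma cf1_total f : cf1 f -> total_computable f.
Proof. by move=> [c Hc]; exists c => n; exact: Hc [:: n] erefl. Qed.

(** * Left-computable enumerability and randomness *)

Section LeftCe.
Variables (R : realType) (z : R) (r : nat) (qa qb : nat -> nat -> nat -> bool) (K : nat -> nat).
Hypothesis hs : halting_system z r qa qb K.

Let A := weight R qa.
Let B := weight R qb.
Let Ai := meas R (stage_limit qa).
Let Bi := meas R (stage_limit qb).

Definition cdiv : nat := (2 ^ r - 1)%N.
(** Numerator over (2^r - 1) 2^s of (1 + d) A_s - B_s; by [weight_num_le] the subtraction does not
    truncate. *)
Definition znum s : nat := (2 ^ r * weight_num qa s - cdiv * weight_num qb s)%N.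
Definition zapp s : R := (znum s)%:R / (cdiv%:R * 2 ^+ s).

Lemma cdiv_gt0 : (0 < cdiv)%N.
Proof. by rewrite subn_gt0 -{1}(expn0 2) ltn_exp2l // (hs_r hs). Qed.

Lemma pow_cdiv : (2 ^ r = cdiv.+1)%N.
Proof. by rewrite /cdiv; have := expn_gt0 2 r; lia. Qed.

Lemma weight_num_le s : (weight_num qb s <= weight_num qa s)%N.
Proof.
rewrite /weight_num; apply: leq_sum => l _; rewrite leq_mul2r; apply/orP; right.
rewrite [leqLHS]big_nat_cond [leqRHS]big_nat_cond.
apply: leq_sum => v /andP[/andP[_ vl] _]; case E: (qb s l v) => //.
by rewrite (hs_sub hs vl E).
Qed.

Lemma zappE s : zapp s = cdiv.+1%:R / cdiv%:R * A s - B s.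
Proof.
have c0 : cdiv%:R != 0 :> R by rewrite pnatr_eq0 -lt0n cdiv_gt0.
rewrite /zapp /znum natrB; last by rewrite pow_cdiv mulSn; have := weight_num_le s; nia.
rewrite !natrM pow_cdiv /A /B /weight; field; by rewrite pow2_neq0.
Qed.

Lemma zE : z = cdiv.+1%:R / cdiv%:R * Ai - Bi.
Proof.
rewrite (hs_z hs); congr (_ / _ * _ - _); first by rewrite -natrX2 pow_cdiv.
by rewrite -natrX2 pow_cdiv -natr1 addrK.
Qed.

Lemma zapp_ge0 s : 0 <= zapp s.
Proof. by rewrite divr_ge0 // mulr_ge0 // exprn_ge0. Qed.

Lemma zapp_cvg : (zapp @ \oo --> z)%classic.
Proof.
rewrite (_ : zapp = fun s => cdiv.+1%:R / cdiv%:R * A s - B s); last first.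
  by apply/funext => s; exact: zappE.
rewrite zE; apply: cvgB; last exact: weight_cvg (hs_ndb hs) (bdb hs).
by apply: cvgMr; exact: weight_cvg (hs_nda hs) (hs_bda hs).
Qed.

(** The gap spends 1 + d/2 of the factor 1 + d on B; the remaining d/2 = 1/(2(2^r - 1)) is at least
    2^-(r+1). *)
Lemma zapp_gap : exists s1, forall s, (s1 <= s)%N -> (Ai - A s) / 2 ^+ r.+1 <= z - zapp s.
Proof.
have [s1 H] := eventual_gap hs; exists s1 => s /H h.
have {}h : 2 * cdiv%:R * (Bi - B s) <= (2 * cdiv%:R + 1) * (Ai - A s).
  by rewrite -natrM natr1; exact: h.
have c0 : 0 < cdiv%:R :> R by rewrite ltr0n cdiv_gt0.
rewrite zappE zE.
have AA : 0 <= Ai - A s by rewrite subr_ge0; exact: weight_le_meas (hs_nda hs) (hs_bda hs).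
apply: le_trans (_ : (Ai - A s) / (2 * cdiv%:R) <= _).
  rewrite ler_wpM2l // lef_pV2 ?posrE ?exprn_gt0 ?mulr_gt0 //.
  by rewrite exprS ler_pM2l // -natrX2 pow_cdiv ler_nat.
rewrite ler_pdivrMr ?mulr_gt0 // -natr1.
have -> : ((cdiv%:R + 1) / cdiv%:R * Ai - Bi - ((cdiv%:R + 1) / cdiv%:R * A s - B s)) * (2 * cdiv%:R)
  = 2 * (cdiv%:R + 1) * (Ai - A s) - 2 * cdiv%:R * (Bi - B s).
  by field; rewrite gt_eqF.
lra.
Qed.

Lemma cf_znum : cf1 znum.
Proof.
apply: cf_sub; apply: cf_mul; try cfauto.
  exact: (cf_weight_num (hs_cfa hs)).
exact: (cf_weight_num (hs_cfb hs)).
Qed.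

Lemma zapp_le s1 : (forall s, (s1 <= s)%N -> (Ai - A s) / 2 ^+ r.+1 <= z - zapp s) ->
  forall s, (s1 <= s)%N -> zapp s <= z.
Proof.
move=> H s /H h; rewrite -subr_ge0; apply: le_trans h; rewrite divr_ge0 ?exprn_ge0 //.
by rewrite subr_ge0; exact: weight_le_meas (hs_nda hs) (hs_bda hs).
Qed.

Lemma left_ce_z : left_ce z.
Proof.
have [s1 /zapp_le H] := zapp_gap.
(* [zapp] need not increase but stays below z from s1 on, so its running maximum is taken; the
   factor 2 accounts for the halved unit. *)
pose m n := iteri n (fun i y => maxn (2 * y) (znum (s1 + i.+1))) (znum s1).
pose d n := (cdiv * 2 ^ (s1 + n)).-1.
have dE n : (d n).+1 = (cdiv * 2 ^ (s1 + n))%N.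
  by rewrite prednK // muln_gt0 cdiv_gt0 expn_gt0.
have c0 : 0 < cdiv%:R :> R by rewrite ltr0n cdiv_gt0.
exists m, (fun _ => 0%N), d; split.
- apply: cf1_total; apply: (@cf_iteri _ _ _ (fun i y v => maxn (2 * y) (znum (s1 + i.+1)))); [cfauto|cfauto|].
  by apply: cf_max; [cfauto|apply: (cf_app1 cf_znum); cfauto].
- by apply: cf1_total; exact: cf_const.
- by apply: cf1_total; rewrite /cf1; cfauto.
move=> q.
have qE n : q n = (m n)%:R / (cdiv%:R * 2 ^+ (s1 + n)).
  by rewrite /q subr0 dE natrM natrX2.
have pos n : 0 < cdiv%:R * 2 ^+ (s1 + n) :> R by rewrite mulr_gt0 ?exprn_gt0.
have qS n : q n.+1 = Num.max (q n) (zapp (s1 + n.+1)).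
  rewrite !qE /m /= -/(m n) natr_max maxr_pMl ?invr_ge0 ?ltW ?pos //; congr Num.max.
  by rewrite natrM addnS exprS [cdiv%:R * (_ * _)]mulrCA -mulf_div divff ?mul1r ?pnatr_eq0.
split.
  by move=> n; rewrite qS le_max lexx.
have qle n : q n <= z.
  elim: n => [|n IH]; first by rewrite qE /= addn0; exact: H.
  by rewrite qS ge_max IH H // leq_addr.
have qge n : zapp (s1 + n)%N <= q n.
  by case: n => [|n]; [rewrite qE /= addn0|rewrite qS le_max lexx orbT].
apply: (@squeeze_cvgr _ _ _ _ (fun n => zapp (s1 + n)%N) (fun _ => z)).
- by apply: nearW => n; rewrite qge qle.
- under eq_fun do rewrite addnC.
  by have := zapp_cvg; rewrite -(cvg_shiftn s1).
- exact: cvg_cst.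
Qed.

(** Forcing of A carried over to z through the margin: a request made at stage s lifts z above
    [zapp s], at the additional cost 2^-(r+1). *)
Lemma force_z : exists s1, (forall s, (s1 <= s)%N -> zapp s <= z) /\ forall rq, cf2 rq ->
  (forall e T, \sum_(0 <= t < T) (rq e t)%:R / 2 ^+ t <= 1 :> R) ->
  exists e, forall s, (s1 <= s)%N ->
    zapp s + (rq e s)%:R / 2 ^+ s / 2 ^+ (K e + r.+1) <= z.
Proof.
have [s1 H] := zapp_gap; exists s1; split; first exact: zapp_le H.
move=> rq Hrq Hsum.
have [||e He] := hs_force hs Hrq (g := id) _ _ Hsum; first by rewrite /cf1; cfauto.
  by [].
exists e => s ss1; have := He s s.+1; rewrite big_nat1 -/A -/Ai => h1.
rewrite -lerBrDl; apply: le_trans (H s ss1).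
by rewrite exprD invfM mulrA ler_pM2r ?invr_gt0 ?exprn_gt0 // lerBrDl.
Qed.

End LeftCe.

(** * Forcing the number out of the cylinders of a test *)

Section Random.
Variables (R : realType) (z : R) (r : nat) (qa qb : nat -> nat -> nat -> bool) (K : nat -> nat).
Hypothesis hs : halting_system z r qa qb K.

Local Notation zap := (zapp R r qa qb).
Local Notation znu := (znum r qa qb).
Let Kz e := (K e + r.+1)%N.

Lemma cf_Kz : cf1 Kz.
Proof. by apply: cf_add; [exact: (hs_cfK hs)|cfauto]. Qed.

Lemma zapp_close (e : R) : 0 < e -> exists T, forall t, (T <= t)%N -> `|z - zap t| < e.
Proof. exact: (cvg_seq_near (@zapp_cvg _ _ _ _ _ _ hs)). Qed.

(* If [z] were a dyadic rational, one could effectively wait for the approximation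
   to come close to [z] and then force it beyond. *)
Lemma z_nondyadic k p : z <> p%:R / 2 ^+ k.
Proof.
move=> zE; have [s1 [_ force]] := force_z hs.
have c0 := cdiv_gt0 hs.
pose cond e t := (p * cdiv r * 2 ^ t * 2 ^ Kz e <
  2 ^ k * cdiv r * 2 ^ t + znu t * 2 ^ k * 2 ^ Kz e)%N.
have condP e t : cond e t = (z - zap t < 2 ^- Kz e).
  rewrite /cond -(ltr_nat R) natrD !natrM !natrX2 zE /zapp.
  have pos : 0 < 2 ^+ k * (cdiv r)%:R * 2 ^+ t * 2 ^+ Kz e :> R.
    by rewrite !mulr_gt0 ?exprn_gt0 ?ltr0n.
  rewrite -[RHS](ltr_pM2r pos).
  have c1 : (cdiv r)%:R != 0 :> R by rewrite pnatr_eq0 -lt0n.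
  have -> : (p%:R / 2 ^+ k - (znu t)%:R / ((cdiv r)%:R * 2 ^+ t)) * (2 ^+ k * (cdiv r)%:R * 2 ^+ t * 2 ^+ Kz e)
    = p%:R * (cdiv r)%:R * 2 ^+ t * 2 ^+ Kz e - (znu t)%:R * 2 ^+ k * 2 ^+ Kz e :> R.
    by field; rewrite c1 !pow2_neq0.
  have -> : 2 ^- Kz e * (2 ^+ k * (cdiv r)%:R * 2 ^+ t * 2 ^+ Kz e) = 2 ^+ k * (cdiv r)%:R * 2 ^+ t :> R.
    by field; rewrite pow2_neq0.
  by rewrite ltrBlDr.
pose c e t := (s1 <= t)%N && cond e t.
(* The whole unit of measure is requested, once, at the first stage where the approximation is
   within 2^-(Kz e) of z; serving it would push z above itself. *)
pose rq e t := (if c e t && ~~ has (c e) (iota 0 t) then 2 ^ t else 0)%N.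
have Hc : cf2 (fun e t => nat_of_bool (c e t)).
  have HK j f : cf j f -> cf j (fun v => Kz (f v)) by exact: (cf_app1 cf_Kz).
  have HZ j f : cf j f -> cf j (fun v => znu (f v)) by exact: (cf_app1 (cf_znum hs)).
  have HP j f : cf j f -> cf j (fun v => 2 ^ Kz (f v))%N by move=> Hf; apply: cf_exp; [cfauto|exact: HK].
  apply: cf_and; first cfauto.
  apply: cf_leq; last first.
    by apply: cf_add; [cfauto|apply: cf_mul; [apply: cf_mul; [apply: HZ|]|apply: HP]; cfauto].
  by apply: cf_succ; apply: cf_mul; [cfauto|apply: HP; cfauto].
have [||e He] := force rq.
- apply: cf_if; [apply: cf_and|cfauto|cfauto]; first exact: Hc.
  apply: cf_neg; apply: (@cf_has _ _ (fun u v => c (nth 0%N v 0) u)); first cfauto.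
  by apply: (cf_app2 Hc); cfauto.
- move=> e T; apply: (@le_trans _ _ (if has (c e) (iota 0 T) then 1 else 0)); last by case: ifP.
  elim: T => [|T IH]; first by rewrite big_geq.
  have -> : has (c e) (iota 0 T.+1) = has (c e) (iota 0 T) || c e T.
    by rewrite -addn1 iotaD has_cat /= orbF.
  rewrite big_nat_recr //= /rq.
  case: (has (c e) (iota 0 T)) IH => /= IH; first by rewrite andbF mul0r addr0.
  rewrite andbT; case: (c e T) => /=; last by rewrite mul0r addr0.
  by rewrite natrX2 mulfV ?pow2_neq0 // -lerBrDr subrr.
have [T HT] := zapp_close (ltac:(by rewrite invr_gt0 exprn_gt0) : 0 < 2 ^- Kz e).
have ex : exists t, c e t.
  exists (maxn s1 T); rewrite /c leq_maxl condP.
  by apply: le_lt_trans (HT _ (leq_maxr _ _)); exact: ler_norm.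
have ct := ex_minnP ex; move: ct; case: ex_minnP => t ct tmin _.
have := He t; case/andP: (ct) => st; rewrite condP => h1 /(_ st).
rewrite /rq ct /=; have -> : has (c e) (iota 0 t) = false.
  by apply/negP => /hasP[u]; rewrite mem_iota add0n => /andP[_ ut] /tmin; lia.
rewrite natrX2 mulfV ?pow2_neq0 // mul1r -/(Kz e) ; move: h1; set y := 2 ^- Kz e; lra.
Qed.

(** The integer part of 2^t times [zapp t]. *)
Definition zfl t : nat := (znu t %/ cdiv r)%N.

Lemma zflP x t : (x <= zfl t)%N = (x%:R / 2 ^+ t <= zap t).
Proof.
rewrite /zfl leq_divRL ?(cdiv_gt0 hs) // -(ler_nat R) natrM.
have c0 : 0 < (cdiv r)%:R :> R by rewrite ltr0n (cdiv_gt0 hs).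
rewrite ler_pdivrMr ?exprn_gt0 // /zapp.
have -> : (znu t)%:R / ((cdiv r)%:R * 2 ^+ t) * 2 ^+ t = (znu t)%:R / (cdiv r)%:R :> R.
  by field; rewrite pow2_neq0 gt_eqF.
by rewrite ler_pdivlMr.
Qed.

Section Test.
Variables (F0 : nat) (cW : code) (s1 : nat).

(* [target], [front] and [demand] are in units of [2 ^ - t]: [target n t] is the right end
   of an enumerated cylinder containing the approximation, and [front n t] the point up to
   which growth has already been demanded. [F0] is the integer part of [z]. *)
Definition inW n t l v : bool := (0 < run cW t [:: n; (2 ^ l + v).-1])%N.
(** The test concerns fractional parts, so the cylinder of (l, v) is placed at F0 + v/2^l. Right
    ends are positive, which lets 0 stand for no candidate. *)
Definition cand n t l v : nat :=
  if [&& inW n t l v, (F0 * 2 ^ l + v) * 2 ^ (t - l) <= zfl t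
      & zfl t < (F0 * 2 ^ l + v).+1 * 2 ^ (t - l)]%N
  then ((F0 * 2 ^ l + v).+1 * 2 ^ (t - l))%N else 0%N.
Definition target n t : nat :=
  (\max_(0 <= l < t.+1) \max_(0 <= v < 2 ^ l) cand n t l v)%N.
Fixpoint front n t : nat :=
  match t with
  | 0 => 0%N
  | t'.+1 => (2 * (if (s1 <= t') && (front n t' <= zfl t')
                   then maxn (front n t') (target n t') else front n t'))%N
  end.
Definition demand n t : nat :=
  if (s1 <= t)%N && (front n t <= zfl t)%N then (target n t - zfl t)%N else 0%N.

Lemma cf_zfl : cf1 zfl.
Proof. by apply: cf_div; [exact: (cf_znum hs)|cfauto]. Qed.

Lemma cf_target : cf2 target.
Proof.
have HZ j f : cf j f -> cf j (fun v => zfl (f v)) by exact: (cf_app1 cf_zfl).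
have Hc : cf4 cand.
  apply: cf_if; [|cfauto|cfauto].
  apply: cf_and.
    by apply: cf_leq; [cfauto|apply: (cf_app3 (cf_run2 cW)); cfauto].
  by apply: cf_and; apply: cf_leq; do ?[cfauto|apply: cf_succ|apply: HZ].
apply: (@cf_bigmax _ _ (fun l u => \max_(0 <= v < 2 ^ l) cand (nth 0 u 0) (nth 0 u 1) l v)%N); first cfauto.
apply: (@cf_bigmax _ _ (fun v u => cand (nth 0 (behead u) 0) (nth 0 (behead u) 1) (nth 0 u 0) v)%N); first cfauto.
by apply: (cf_app4 Hc); cfauto.
Qed.

Lemma cf_front : cf2 front.
Proof.
apply: (@cf_ext _ (fun v => iteri (nth 0 v 1) (fun t' y => 2 * (if (s1 <= t') && (y <= zfl t')
                   then maxn y (target (nth 0 v 0) t') else y)) 0)%N).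
  by move=> v _; elim: (nth _ v 1%N) => //= t ->.
apply: (@cf_iteri _ _ _ (fun t' y v => 2 * (if (s1 <= t') && (y <= zfl t')
                   then maxn y (target (nth 0 v 0) t') else y))%N); [cfauto|cfauto|].
apply: cf_mul; first cfauto; apply: cf_if; last cfauto.
  by apply: cf_and; [cfauto|apply: cf_leq; [cfauto|apply: (cf_app1 cf_zfl); cfauto]].
by apply: cf_max; [cfauto|apply: (cf_app2 cf_target); cfauto].
Qed.

Lemma cf_demand : cf2 demand.
Proof.
apply: cf_if; last cfauto.
  apply: cf_and; first cfauto.
  by apply: cf_leq; [exact: cf_front|apply: (cf_app1 cf_zfl); cfauto].
by apply: cf_sub; [exact: cf_target|apply: (cf_app1 cf_zfl); cfauto].
Qed.

Lemma bigmax_witness (f : nat -> nat) n : (0 < \max_(0 <= i < n) f i)%N ->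
  exists2 i, (i < n)%N & (\max_(0 <= i < n) f i)%N = f i.
Proof.
elim: n => [|n IH]; first by rewrite big_geq.
rewrite big_nat_recr //= => h; case: (leqP (f n) (\max_(0 <= i < n) f i)%N) => le.
  have [|i lin E] := IH; first by move: h; rewrite leq_max; lia.
  by exists i; [lia|].
by exists n.
Qed.

Lemma targetP n t : (0 < target n t)%N -> exists l v, [/\ (l <= t)%N, (v < 2 ^ l)%N, inW n t l v,
  ((F0 * 2 ^ l + v) * 2 ^ (t - l) <= zfl t < (F0 * 2 ^ l + v).+1 * 2 ^ (t - l))%N
  & target n t = ((F0 * 2 ^ l + v).+1 * 2 ^ (t - l))%N].
Proof.
rewrite /target => h; have [l lt E] := bigmax_witness h; rewrite E in h.
have [v vl E2] := bigmax_witness h; rewrite E2 in h E.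
move: h E; rewrite /cand; case: ifP => // /and3P[h1 h2 h3] _ E.
by exists l, v; rewrite h2 h3; split.
Qed.

Lemma le_bigmax_nat (f : nat -> nat) n i : (i < n)%N -> (f i <= \max_(0 <= j < n) f j)%N.
Proof.
elim: n => // n IH; rewrite ltnS leq_eqVlt big_nat_recr //= leq_max => /orP[/eqP->|/IH ->//].
by rewrite leqnn orbT.
Qed.

Lemma le_target n t l v : (l <= t)%N -> (v < 2 ^ l)%N -> (cand n t l v <= target n t)%N.
Proof.
rewrite -ltnS => lt vl.
have h1 := le_bigmax_nat (fun l => \max_(0 <= v < 2 ^ l) cand n t l v)%N lt.
by apply: leq_trans h1; exact: (le_bigmax_nat (cand n t l) vl).
Qed.

Variable Wn : nat -> seq bool -> Prop.
Hypothesis WnP : forall n s, Wn n s <-> exists y, eval cW [:: n; enc s] y.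

Lemma inWP n t l v : (v < 2 ^ l)%N -> inW n t l v -> Wn n (str l v).
Proof.
move=> vl; rewrite /inW WnP enc_str //; case E: (run cW t _) => [//|y] _.
by exists y; apply/evalP; exists t.
Qed.

Lemma inW_eventually n s : Wn n s -> exists T, forall t, (T <= t)%N -> inW n t (size s) (bval s).
Proof.
move=> /WnP[y /evalP[T HT]]; exists T => t Tt; rewrite /inW -encE.
by rewrite (runS Tt HT).
Qed.

Let cov n k y := `[< exists w, Wn n w /\ prefix w (str k y) >].

Lemma front_le n t : (front n t <= F0.+1 * 2 ^ t)%N.
Proof.
elim: t => [|t IH] //=; rewrite expnS mulnCA leq_mul2l /=; case: ifP => // _.
rewrite geq_max IH /=; case: (posnP (target n t)) => [->//|/targetP[l [v [lt vl _ _ ->]]]].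
have -> : (2 ^ t = 2 ^ l * 2 ^ (t - l))%N by rewrite -expnD subnKC.
by rewrite mulnA leq_mul2r; apply/orP; right; rewrite mulSn; lia.
Qed.

(** A demand is made only when the approximation has reached the front. The segment from the
    approximation to the target then lies beyond all earlier segments and inside an enumerated
    cylinder, and the front moves to its end. The segments are thus disjoint and covered; the
    maximum is there because the front starts at 0, below F0. *)
Lemma demand_cover n T k : (T <= k)%N ->
  (\sum_(0 <= t < T) demand n t * 2 ^ (k - t) <=
   \sum_(F0 * 2 ^ k <= y < maxn (F0 * 2 ^ k) (front n T * 2 ^ (k - T))) cov n k (y - F0 * 2 ^ k))%N.
Proof.
elim: T => [|T IH] Tk; first by rewrite big_geq.
have {}IH := IH (ltnW Tk).
have pk : (2 * 2 ^ (k - T.+1) = 2 ^ (k - T))%N by rewrite -expnS; congr (2 ^ _)%N; lia.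
have -> : (front n T.+1 * 2 ^ (k - T.+1) = (if (s1 <= T) && (front n T <= zfl T)
    then maxn (front n T) (target n T) else front n T) * 2 ^ (k - T))%N.
  by rewrite -pk mulnA; congr muln; rewrite mulnC.
rewrite big_nat_recr //= /demand.
case: ifP => [/andP[_ fz]|_]; last by rewrite mul0n addn0.
case: (posnP (target n T)) => [->|/targetP[l [v [lT vl Wv /andP[z1 z2] ->]]]].
  by rewrite sub0n mul0n addn0 maxn0.
set m := ((F0 * 2 ^ l + v).+1 * 2 ^ (T - l))%N in z2 *.
have fm : (front n T <= m)%N by lia.
rewrite (maxn_idPr fm).
have bz : (F0 * 2 ^ k <= zfl T * 2 ^ (k - T))%N.
  apply: leq_trans (_ : (F0 * 2 ^ l + v) * 2 ^ (T - l) * 2 ^ (k - T) <= _)%N; last by rewrite leq_mul2r z1 orbT.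
  rewrite -mulnA -expnD; have -> : (T - l + (k - T) = k - l)%N by lia.
  rewrite mulnDl -mulnA -expnD subnKC; [exact: leq_addr|lia].
have zm : (zfl T * 2 ^ (k - T) <= m * 2 ^ (k - T))%N by rewrite leq_mul2r (ltnW z2) orbT.
have fz' : (maxn (F0 * 2 ^ k) (front n T * 2 ^ (k - T)) <= zfl T * 2 ^ (k - T))%N.
  by rewrite geq_max bz leq_mul2r fz orbT.
rewrite (maxn_idPr (leq_trans bz zm)) [leqRHS](big_cat_nat (n := zfl T * 2 ^ (k - T))) //=.
apply: leq_add.
  by apply: leq_trans IH _; rewrite [leqRHS](big_cat_nat (n := maxn (F0 * 2 ^ k) (front n T * 2 ^ (k - T)))) ?leq_maxl //= leq_addr.
rewrite (eq_big_nat _ _ (F2 := fun=> 1%N)).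
  by rewrite sum_nat_const_nat mulnBl muln1.
move=> y /andP[y1 y2].
have yk : (y - F0 * 2 ^ k < 2 ^ k)%N.
  suff : (m * 2 ^ (k - T) <= F0.+1 * 2 ^ k)%N by rewrite mulSn; lia.
  rewrite /m -mulnA -expnD; have -> : (T - l + (k - T) = k - l)%N by lia.
  have -> : (2 ^ k = 2 ^ l * 2 ^ (k - l))%N by rewrite -expnD; congr (2 ^ _)%N; lia.
  by rewrite mulnA leq_mul2r; apply/orP; right; rewrite mulSn; lia.
have -> // : cov n k (y - F0 * 2 ^ k).
apply/asboolP; exists (str l v); split; first exact: inWP Wv.
rewrite prefix_str !size_str !val_str //.
have lk : (l <= k)%N by lia.
rewrite lk /=; apply/eqP.
have e1 : (T - l + (k - T) = k - l)%N by lia.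
have e2 : (2 ^ k = 2 ^ l * 2 ^ (k - l))%N by rewrite -expnD; congr (2 ^ _)%N; lia.
have y1' : ((F0 * 2 ^ l + v) * 2 ^ (k - l) <= y)%N.
  apply: leq_trans y1; rewrite -e1 expnD mulnA leq_mul2r z1 orbT //.
have y2' : (y < (F0 * 2 ^ l + v).+1 * 2 ^ (k - l))%N.
  by apply: leq_trans y2 _; rewrite -e1 expnD mulnA.
have q : (y %/ 2 ^ (k - l) = F0 * 2 ^ l + v)%N.
  apply/eqP; rewrite eqn_leq -ltnS ltn_divLR ?expn_gt0 // y2' /= leq_divRL ?expn_gt0 //.
rewrite e2 mulnA.
have -> : (y = (y - F0 * 2 ^ l * 2 ^ (k - l)) + F0 * 2 ^ l * 2 ^ (k - l))%N.
  by rewrite subnK //; apply: leq_trans y1'; rewrite mulnDl leq_addr.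
rewrite addnK; apply/eqP; rewrite -(eqn_add2l (F0 * 2 ^ l)); apply/eqP.
rewrite -q [in RHS](_ : y = (F0 * 2 ^ l) * 2 ^ (k - l) + (y - F0 * 2 ^ l * 2 ^ (k - l)))%N.
  by rewrite divnMDl ?expn_gt0.
by rewrite subnKC //; apply: leq_trans y1'; rewrite mulnDl leq_addr.
Qed.

Lemma demand_sum n T : \sum_(0 <= t < T) (demand n t)%:R / 2 ^+ t <= lambda_open R (Wn n).
Proof.
have bound k : (cyl_count (Wn n) k)%:R / 2 ^+ k <= 1 :> R.
  rewrite ler_pdivrMr ?exprn_gt0 // mul1r -natrX2 ler_nat.
  apply: leq_trans (max_card _) _; rewrite card_tuple card_bool //.
apply: le_trans (_ : (cyl_count (Wn n) T)%:R / 2 ^+ T <= _); last first.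
  apply: ub_le_sup; last by exists T.
  by exists 1 => _ [k _ <-].
rewrite ler_pdivlMr ?exprn_gt0 //.
apply: le_trans (_ : (\sum_(0 <= t < T) demand n t * 2 ^ (T - t))%N%:R <= _).
  rewrite natr_sum big_distrl /=; apply: ler_sum_nat => t /andP[_ tT].
  have -> : 2 ^+ T = 2 ^+ (T - t) * 2 ^+ t :> R by rewrite -exprD subnK // ltnW.
  by rewrite natrM natrX2 mulrA mulrAC divfK ?pow2_neq0.
rewrite ler_nat; apply: leq_trans (demand_cover n (leqnn T)) _.
rewrite subnn muln1 /cyl_count.
have -> : #|[set s : T.-tuple bool | `[< exists w, Wn n w /\ prefix w (tval s) >]]| =
   (\sum_(0 <= v < 2 ^ T) cov n T v)%N.
  exact: (card_tuples T (fun s => `[< exists w, Wn n w /\ prefix w s >])).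
have fl : (maxn (F0 * 2 ^ T) (front n T) <= 2 ^ T + F0 * 2 ^ T)%N.
  by rewrite geq_max leq_addl /= -mulSn front_le.
rewrite -{1}[(F0 * 2 ^ T)%N]add0n big_addn.
rewrite [leqRHS](big_cat_nat (n := maxn (F0 * 2 ^ T) (front n T) - F0 * 2 ^ T)) //=; last by lia.
by under eq_bigr do rewrite addnK; exact: leq_addr.
Qed.

End Test.
End Random.

Lemma bval_bits (R : realType) (f : R) k : 0 <= f < 1 ->
  bval (mkseq (fun n => odd (Num.truncn (2 ^+ n.+1 * f))) k) = Num.truncn (2 ^+ k * f).
Proof.
move=> /andP[f0 f1]; elim: k => [|k IH].
  by rewrite expr0 mul1r; apply/esym/truncn_def; rewrite f0 f1.
rewrite mkseqS bval_rcons IH; set m := Num.truncn (2 ^+ k.+1 * f).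
suff -> : Num.truncn (2 ^+ k * f) = m./2 by rewrite addnC odd_double_half.
have /truncn_itv /andP[h1 h2] : 0 <= 2 ^+ k.+1 * f by rewrite mulr_ge0 // exprn_ge0.
apply: truncn_def.
rewrite -(ler_pM2l (x := 2)) // mulrA -exprS -[X in _ && X](ltr_pM2l (x := 2)) // mulrA -exprS.
apply/andP; split.
  by apply: le_trans h1; rewrite -natrM ler_nat -/m; lia.
by apply: lt_le_trans h2 _; rewrite -natrM ler_nat -/m; lia.
Qed.

(** Places z in the dyadic interval given by its integer part and its first k bits, half-open as in
    [cand]. *)
Lemma frac_bits_bval (R : realType) (z : R) k : 0 <= z ->
  (Num.truncn z * 2 ^ k + bval (mkseq (frac_bits z) k))%N%:R <= z * 2 ^+ k
    < (Num.truncn z * 2 ^ k + bval (mkseq (frac_bits z) k)).+1%:R.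
Proof.
move=> z0; have /andP[h1 h2] := truncn_itv z0.
have fz : (Num.floor z)%:~R = (Num.truncn z)%:R :> R.
  have -> : Num.floor z = Num.truncn z by apply: floor_def; rewrite -natr1 in h2; rewrite h1 intrD.
  by [].
have f01 : 0 <= z - (Num.truncn z)%:R < 1 by rewrite subr_ge0 h1 /= ltrBlDl natr1.
rewrite /frac_bits fz (bval_bits k f01).
have /truncn_itv /andP[] : 0 <= 2 ^+ k * (z - (Num.truncn z)%:R).
  by rewrite mulr_ge0 ?exprn_ge0 //; case/andP: f01.
set m := Num.truncn (_ * _); rewrite -(natr1 m) -(natr1 (_ + _)) natrD natrM natrX2 mulrBr => k1 k2.
by apply/andP; split; lra.
Qed.

Lemma random_z (R : realType) (z : R) r qa qb K W : halting_system z r qa qb K ->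
  ML_test R W -> ~ forall n, exists w, W n w /\ w = mkseq (frac_bits z) (size w).
Proof.
move=> hs [[cW HcW] lamW] Hall.
have [s1 [Hle force]] := force_z hs.
have z0 : 0 <= z by apply: le_trans (Hle s1 (leqnn _)); exact: zapp_ge0.
pose F0 := Num.truncn z.
pose Kz e := (K e + r.+1)%N.
pose dem := demand r qa qb F0 cW s1.
(* Index e plays against level [Kz e] of the test, whose measure at most 2^-(Kz e) leaves room for
   the factor lost in serving. *)
pose rq e t := (2 ^ Kz e * dem (Kz e) t)%N.
have rqE e t : (rq e t)%:R / 2 ^+ t = 2 ^+ Kz e * ((dem (Kz e) t)%:R / 2 ^+ t) :> R.
  by rewrite /rq natrM natrX2 mulrA.
have [||e He] := force rq.
- have HK k f : cf k f -> cf k (fun v => Kz (f v)) by exact: (cf_app1 (cf_Kz hs)).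
  apply: cf_mul; first by apply: cf_exp; [cfauto|apply: HK; cfauto].
  by apply: (cf_app2 (cf_demand hs F0 cW s1)); [apply: HK|]; cfauto.
- move=> e T; under eq_bigr do rewrite rqE; rewrite -big_distrr /=.
  rewrite -ler_pdivlMl ?exprn_gt0 // mulr1; apply: le_trans (lamW (Kz e)).
  exact: (demand_sum R r qa qb F0 s1 HcW).
pose n := Kz e.
have {}He t : (s1 <= t)%N -> zapp R r qa qb t + (dem n t)%:R / 2 ^+ t <= z.
  by move=> /He; rewrite rqE -/(Kz e) mulrAC mulfV ?pow2_neq0 // mul1r.
have zflE t : (zfl r qa qb t)%:R / 2 ^+ t <= zapp R r qa qb t by rewrite -(zflP hs).
pose fro := front r qa qb F0 cW s1 n.
pose tar := target r qa qb F0 cW n.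
have fire t : (s1 <= t)%N -> (fro t <= zfl r qa qb t)%N -> (tar t)%:R / 2 ^+ t <= z.
  move=> st fz; case: (leqP (tar t) (zfl r qa qb t)) => le.
    apply: le_trans (Hle t st); apply: le_trans (zflE t).
    by rewrite ler_pM2r ?invr_gt0 ?exprn_gt0 // ler_nat.
  have := He t st; rewrite /dem /demand st fz /= natrB ?(ltnW le) // mulrBl.
  by have := zflE t; rewrite -/tar; lra.
(* The front moves only to targets, and by [fire] z reaches each of these. *)
have fro_le t : (fro t)%:R / 2 ^+ t <= z.
  elim: t => [|t IH]; first by rewrite mul0r.
  rewrite /fro /= -/(fro t) natrM exprS invfM mulrACA mulfV ?pnatr_eq0 // mul1r.
  case: ifP => [/andP[st fz]|_]; last exact: IH.
  by case: leqP => _; [exact: fire|exact: IH].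
have [w [Ww wE]] := Hall n.
pose l := size w; pose v := bval w.
have vl : (v < 2 ^ l)%N by exact: bval_lt.
have := frac_bits_bval l z0; rewrite -wE -/v -/F0 => /andP[lo hi].
(* Strictness, from [z_nondyadic], is what brings the approximation into the cylinder of w
   eventually. *)
have {}lo : (F0 * 2 ^ l + v)%N%:R / 2 ^+ l < z.
  rewrite lt_neqAle ler_pdivrMr ?exprn_gt0 // lo andbT; apply/eqP => /esym.
  exact: (z_nondyadic hs).
have {}hi : z < (F0 * 2 ^ l + v).+1%:R / 2 ^+ l by rewrite ltr_pdivlMr ?exprn_gt0.
have [T0 HT0] := zapp_close hs (ltac:(rewrite subr_gt0; exact: lo) : 0 < z - (F0 * 2 ^ l + v)%N%:R / 2 ^+ l).
have [T1 HT1] := inW_eventually HcW Ww.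
(* A late demand would have a target at or beyond the right end of the cylinder of w, pushing z out
   of it although w is an initial segment of its expansion. *)
have nofire t : (maxn (maxn T0 T1) (maxn s1 l) <= t)%N -> (zfl r qa qb t < fro t)%N.
  rewrite !geq_max => /andP[/andP[t0 t1] /andP[ts tl]]; rewrite ltnNge; apply/negP => fz.
  have sc x : ((x * 2 ^ (t - l))%N%:R / 2 ^+ t = x%:R / 2 ^+ l :> R).
    have -> : 2 ^+ t = 2 ^+ (t - l) * 2 ^+ l :> R by rewrite -exprD subnK.
    by rewrite natrM natrX2 invfM mulrA mulfK ?pow2_neq0.
  have c1 : ((F0 * 2 ^ l + v) * 2 ^ (t - l) <= zfl r qa qb t)%N.
    rewrite (zflP hs) sc; have := HT0 t t0; have := ler_norm (z - zapp R r qa qb t); lra.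
  have c2 : (zfl r qa qb t < (F0 * 2 ^ l + v).+1 * 2 ^ (t - l))%N.
    rewrite ltnNge (zflP hs) sc -ltNge; exact: le_lt_trans (Hle t ts) hi.
  have := le_target r qa qb F0 cW n tl vl; rewrite /cand (HT1 t t1) c1 c2 /= -/(tar t).
  rewrite -(ler_nat R) -(ler_pM2r (x := (2 ^+ t)^-1)) ?invr_gt0 ?exprn_gt0 // sc => h.
  by have := fire t ts fz; lra.
set T := maxn _ _ in nofire.
(* Without demands the front is constant as a real; it lies strictly below z, which is not dyadic,
   so the approximation reaches it, against [nofire]. *)
have frozen k : fro (T + k)%N = (fro T * 2 ^ k)%N.
  elim: k => [|k IH]; first by rewrite addn0 muln1.
  rewrite addnS /fro /= -/(fro (T + k)%N) [(fro _ <= _)%N]leqNgt nofire ?leq_addr // andbF IH expnS.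
  by rewrite mulnCA.
have lt : (fro T)%:R / 2 ^+ T < z.
  by rewrite lt_neqAle fro_le andbT; apply/eqP => /esym; exact: (z_nondyadic hs).
have [T2 HT2] := zapp_close hs (ltac:(rewrite subr_gt0; exact: lt) : 0 < z - (fro T)%:R / 2 ^+ T).
have := nofire (T + T2)%N (leq_addr _ _); rewrite frozen ltnNge => /negP; apply.
rewrite (zflP hs) natrM natrX2 exprD invfM mulrACA mulfV ?pow2_neq0 // mulr1.
have := HT2 (T + T2)%N (leq_addl _ _); have := ler_norm (z - zapp R r qa qb (T + T2)%N); lra.
Qed.

Theorem theorem1p3 (R : realType) (L : nat -> pfun) (U : pfun)
  (X : seq bool -> Prop) :
  effective_list_pfm L -> universal_pfm L U ->
  Pi01_set X -> (exists s, X s) ->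
  ML_random_real (halting_prob R U X) /\ left_ce (halting_prob R U X).
Proof.
move=> HL HU HX X0; have [r [qa [qb [K hs]]]] := reduction R HL HU HX X0.
split; last exact: left_ce_z hs.
move=> W HW; apply: contrapT => H; apply: (random_z hs HW) => n.
by apply: contrapT => Hn; apply: H; exists n.
Qed.
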